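(* Let $\Bbbk$ be a field, let $\langle C,\succ\rangle$ be a precommutative algebra over $\Bbbk$ with linear basis $B$, and let $E_0$ be a set of monomials in $B$ chosen as described in the context. Then the set of all $E$-words (defined in the context from $B$ and $E_0$) forms a linear basis of the universal enveloping commutative Rota–Baxter algebra (of weight zero) $U_{\mathrm{RB}}(C)$ of $C$; that is, the images of the $E$-words under the canonical homomorphism from the free commutative Rota–Baxter algebra $\mathrm{RBCom}\langle B\rangle$ onto $U_{\mathrm{RB}}(C)$ are pairwise distinct and form a basis of the vector space $U_{\mathrm{RB}}(C)$.
   Context: All algebras are over a field $\Bbbk$ and are not assumed to have a unit; ''commutative algebra'' means commutative and associative algebra. A linear operator $R$ on an algebra $A$ is a Rota–Baxter operator (RB-operator) of weight $\lambda\in\Bbbk$ if $R(x)R(y)=R(R(x)y+xR(y)+\lambda xy)$ for all $x,y\in A$. Here all RB-operators have weight $0$. A commutative RB-algebra is a commutative algebra with an RB-operator. A precommutative (Zinbiel) algebra is a vector space with a bilinear product $\succ$ satisfying $(x_1\succ x_2+x_2\succ x_1)\succ x_3=x_1\succ(x_2\succ x_3)$. If $U$ is a commutative algebra with an RB-operator $R$ of weight $0$, then $U^{(R)}$ denotes the space $U$ with the product $x\succ y=R(x)y$; it is a precommutative algebra. The universal enveloping commutative RB-algebra $U_{\mathrm{RB}}(C)$ of a precommutative algebra $C$ is the universal commutative RB-algebra $U$ of weight $0$ equipped with a homomorphism $C\to U^{(R)}$ of precommutative algebras; equivalently, for a linear basis $B$ of $C$ it is the quotient $\mathrm{RBCom}\langle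 B\mid b\succ a=R(b)a,\ a,b\in B\rangle$ of the free commutative RB-algebra of weight $0$ generated by $B$, where $b\succ a$ stands for the linear combination of elements of $B$ equal to the product in $C$. Standard base of the free commutative RB-algebra $\mathrm{RBCom}\langle B\rangle$: the smallest set $T$ of words such that all nonempty commutative monomials in $B$ lie in $T$, and if $u\in T$ then $R(u)\in T$ and $R(u)w\in T$ for every nonempty commutative monomial $w$ in $B$. Let $\Bbbk[B]$ denote the polynomial algebra without constant terms, $I$ its ideal generated by $\{(b\succ a)c-(b\succ c)a : a,b,c\in B\}$, where $b\succ a$, $b\succ c$ are the products in $C$, written as linear combinations of elements of $B$. Put $A=\Bbbk[B]/I$. Choose a set $E_0$ of nonempty monomials in $\Bbbk[B]$ whose image in $A$ is a linear basis of $A$ and such that whenever $v\in E_0$ and $v=v_1v_2$ with $v_1,v_2$ nonempty monomials, we have $v_1,v_2\in E_0$ (such a set exists by Gröbner basis theory). An element $R(u)$ of the standard base is called good if $u$ is not of the form $b$ or $R(x)b$ with $b\in B$. $E$-words are the elements of the standard base defined inductively by: (1) elements of $E_0$ are $E$-words of type 1; (2) if $u$ is an $E$-word, then $R(u)$ is an $E$-word of type 2; (3) if $x$ is an $E$-word such that $R(x)$ is good, and $w\in E_0$, then $R(x)w$ is an $E$-word of type 3. *)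

(* Defs.v *)
(* boolp is used only to build the quotients in the existence facts at the
   end. *)
From HB Require Import structures.
From mathcomp Require Import all_boot all_order all_algebra.
From mathcomp Require Import finmap monalg boolp.

Set Implicit Arguments.
Unset Strict Implicit.
Unset Printing Implicit Defensive.

Import GRing.Theory.

Local Open Scope ring_scope.

Definition combination (k : fieldType) (V : lmodType k) (X : Type) (e : X -> V)
    (n : nat) (x : 'I_n -> X) (c : 'I_n -> k) : V :=
  \sum_i c i *: e (x i).

(* The classes of the vectors e x, for x satisfying P, form a linear basis of
   the quotient D / W; they are indexed by x, so in particular distinct x
   satisfying P have distinct classes. *)
Definition basis_mod (k : fieldType) (V : lmodType k) (D W : V -> Prop)
    (X : Type) (P : X -> Prop) (e : X -> V) : Prop :=
  [/\ forall x, P x -> D (e x),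
      forall n (x : 'I_n -> X) (c : 'I_n -> k), injective x ->
        (forall i, P (x i)) -> W (combination e x c) -> forall i, c i = 0 &
      forall v, D v -> exists n (x : 'I_n -> X) (c : 'I_n -> k),
        (forall i, P (x i)) /\ W (v - combination e x c)].

Definition linear_basis (k : fieldType) (V : lmodType k)
    (X : Type) (P : X -> Prop) (e : X -> V) : Prop :=
  basis_mod (fun _ => True) (fun v => v = 0) P e.

(* The product need not be associative and there need not be a unit. *)
Record algebra (k : fieldType) := Algebra {
  alg_sort :> lmodType k;
  amul : alg_sort -> alg_sort -> alg_sort;
  amul_linearl : forall y, linear (amul^~ y);
  amul_linearr : forall x, linear (amul x) }.

Definition alg_hom (k : fieldType) (A B : algebra k) (f : A -> B) : Prop :=
  linear f /\ forall x y, f (amul x y) = amul (f x) (f y).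

Definition rota_baxter (k : fieldType) (lambda : k) (A : algebra k)
    (R : A -> A) : Prop :=
  linear R /\
  forall x y, amul (R x) (R y) =
    R (amul (R x) y + amul x (R y) + lambda *: amul x y).

Record comRBalg (k : fieldType) := ComRBalg {
  rb_alg :> algebra k;
  rbop : rb_alg -> rb_alg;
  rb_mulC : commutative (@amul k rb_alg);
  rb_mulA : associative (@amul k rb_alg);
  rb_axiom : rota_baxter 0 rbop }.

Definition rb_hom (k : fieldType) (U V : comRBalg k) (f : U -> V) : Prop :=
  alg_hom f /\ forall x, f (rbop x) = rbop (f x).

(* amul x y is the product written x > y in precommutative algebras. *)
Record precomm (k : fieldType) := Precomm {
  pc_alg :> algebra k;
  pc_axiom : forall x y z : pc_alg,
    amul (amul x y + amul y x) z = amul x (amul y z) }.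

(* U^(R): the space U with the product R(x)y. *)
Section Derived.
Variables (k : fieldType) (U : comRBalg k).

Definition dmul (x y : U) : U := amul (rbop x) y.

Lemma dmul_linearl y : linear (dmul^~ y).
Proof.
by move=> a u v; rewrite /dmul (rb_axiom U).1 (amul_linearl y).
Qed.

Lemma dmul_linearr x : linear (dmul x).
Proof. exact: amul_linearr. Qed.

Definition derived_alg : algebra k :=
  @Algebra k U dmul dmul_linearl dmul_linearr.

Lemma derived_axiom (x y z : derived_alg) :
  amul (amul x y + amul y x) z = amul x (amul y z).
Proof.
rewrite /= /dmul (rb_mulA (rbop x)) (rb_axiom U).2 scale0r addr0.
by rewrite (rb_mulC x).
Qed.

Definition derived : precomm k := Precomm derived_axiom.

End Derived.

Definition free_comRB (k : fieldType) (I : Type) (F : comRBalg k)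
    (iota : I -> F) : Prop :=
  forall (V : comRBalg k) (g : I -> V),
    exists f : F -> V,
      [/\ rb_hom f, forall i, f (iota i) = g i &
          forall f' : F -> V,
            rb_hom f' -> (forall i, f' (iota i) = g i) -> f' =1 f].

Definition universal_envelope (k : fieldType) (C : precomm k) (U : comRBalg k)
    (phi : C -> derived U) : Prop :=
  alg_hom phi /\
  forall (V : comRBalg k) (psi : C -> derived V), alg_hom psi ->
    exists f : U -> V,
      [/\ rb_hom f, forall x, f (phi x) = psi x &
          forall f' : U -> V,
            rb_hom f' -> (forall x, f' (phi x) = psi x) -> f' =1 f].

Definition monomial (I : choiceType) : Type :=
  {m : {cmonom I} | m != mone}.

(* The smallest set T of the standard base: b1...bn, R(u) and R(u)w. *)
Inductive word (I : choiceType) : Type :=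
  | WMon of monomial I
  | WR of word I
  | WRMon of word I & monomial I.

Definition letters (I : choiceType) (m : {cmonom I}) : seq I :=
  flatten [seq nseq (m i) i | i <- finsupp m].

(* Value of the monomial m at g; without a unit the product must be nonempty,
   and the default 0 is only reached by the empty monomial. *)
Definition mon_eval (k : fieldType) (U : comRBalg k) (I : choiceType)
    (g : I -> U) (m : {cmonom I}) : U :=
  if [seq g i | i <- letters m] is x :: s then foldl (@amul k U) x s else 0.

Fixpoint word_eval (k : fieldType) (U : comRBalg k) (I : choiceType)
    (g : I -> U) (u : word I) : U :=
  match u with
  | WMon m => mon_eval g (val m)
  | WR x => rbop (word_eval g x)
  | WRMon x w => amul (rbop (word_eval g x)) (mon_eval g (val w))
  end.

(* k[B] is the subspace of the polynomials without constant term. *)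
Definition no_const (k : fieldType) (I : choiceType)
    (p : {malg k[{cmonom I}]}) : Prop :=
  p@_mone = 0.

(* p is the element c of C, written as a linear combination of the variables
   attached to the basis b. *)
Definition linear_form (k : fieldType) (C : precomm k) (I : choiceType)
    (b : I -> C) (c : C) (p : {malg k[{cmonom I}]}) : Prop :=
  exists n (x : 'I_n -> I) (a : 'I_n -> k),
    c = combination b x a /\ p = combination (fun i => << ucm i >>) x a.

(* The ideal I of k[B]; amul (b i) (b j) enters as a linear form. *)
Inductive ideal (k : fieldType) (C : precomm k) (I : choiceType)
    (b : I -> C) : {malg k[{cmonom I}]} -> Prop :=
  | ideal_gen i j l p q :
      linear_form b (amul (b i) (b j)) p ->
      linear_form b (amul (b i) (b l)) q ->
      ideal b (p * << ucm l >> - q * << ucm j >>)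
  | ideal_0 : ideal b 0
  | ideal_add p q : ideal b p -> ideal b q -> ideal b (p + q)
  | ideal_scale a p : ideal b p -> ideal b (a *: p)
  | ideal_mul p q : no_const p -> ideal b q -> ideal b (p * q).

(* E0 maps to a linear basis of A = k[B] / I and is closed under nonempty
   divisors. *)
Definition admissible (k : fieldType) (C : precomm k) (I : choiceType)
    (b : I -> C) (E0 : monomial I -> Prop) : Prop :=
  basis_mod (@no_const k I) (ideal b) E0
    (fun m => << val m >> : {malg k[{cmonom I}]}) /\
  forall v v1 v2 : monomial I,
    E0 v -> val v = mmul (val v1) (val v2) -> E0 v1 /\ E0 v2.

(* R(u) is good: u is neither b nor R(x)b with b in B. *)
Definition good (I : choiceType) (u : word I) : Prop :=
  match u with
  | WMon m => forall i, val m <> ucm i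
  | WRMon _ w => forall i, val w <> ucm i
  | WR _ => True
  end.

Inductive Eword (I : choiceType) (E0 : monomial I -> Prop) : word I -> Prop :=
  | Eword1 m : E0 m -> Eword E0 (WMon m)
  | Eword2 u : Eword E0 u -> Eword E0 (WR u)
  | Eword3 x w : Eword E0 x -> good x -> E0 w -> Eword E0 (WRMon x w).

Lemma count_letters (I : choiceType) (m : {cmonom I}) i :
  count_mem i (letters m) = m i.
Proof.
rewrite /letters count_flatten -map_comp sumnE big_map.
case: (boolP (i \in finsupp m)) => mi.
  rewrite (big_rem i) //= count_nseq /= eqxx mul1n.
  rewrite big_seq big1 ?addn0 // => j.
  rewrite mem_rem_uniq ?fset_uniq // inE => /andP[ji _].
  by rewrite count_nseq /= (negbTE ji).
rewrite big_seq big1 => [|j jm]; first by rewrite (fsfun_dflt mi).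
rewrite /= count_nseq /=; case: eqP => // ji.
by rewrite -ji jm in mi.
Qed.

Lemma mon_eval_var (k : fieldType) (U : comRBalg k) (I : choiceType)
    (g : I -> U) (i : I) : mon_eval g (ucm i) = g i.
Proof.
rewrite /mon_eval; suff -> : letters (ucm i) = [:: i] by [].
apply: perm_small_eq => //; apply/allP => j _ /=.
by rewrite count_letters cmU addn0.
Qed.

(* Both universal objects exist: they are quotients of the set of formal
   expressions over a set G by the congruence generated by the identities of
   commutative RB-algebras and by given relations. *)
Section Presentation.
Variables (k : fieldType) (G : Type).

Inductive term : Type :=
  | TGen of G
  | TZero
  | TAdd of term & term
  | TScale of k & term
  | TMul of term & term
  | TR of term.

Variable rel : term -> term -> Prop.

Inductive cong : term -> term -> Prop :=
  | cong_rel s t : rel s t -> cong s t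
  | cong_refl t : cong t t
  | cong_sym s t : cong s t -> cong t s
  | cong_trans s t u : cong s t -> cong t u -> cong s u
  | cong_add s s' t t' :
      cong s s' -> cong t t' -> cong (TAdd s t) (TAdd s' t')
  | cong_scale a s s' : cong s s' -> cong (TScale a s) (TScale a s')
  | cong_mul s s' t t' :
      cong s s' -> cong t t' -> cong (TMul s t) (TMul s' t')
  | cong_R s s' : cong s s' -> cong (TR s) (TR s')
  | cong_addA s t u : cong (TAdd s (TAdd t u)) (TAdd (TAdd s t) u)
  | cong_addC s t : cong (TAdd s t) (TAdd t s)
  | cong_add0 s : cong (TAdd TZero s) s
  | cong_addN s : cong (TAdd (TScale (-1) s) s) TZero
  | cong_scaleA a a' s : cong (TScale a (TScale a' s)) (TScale (a * a') s)
  | cong_scale1 s : cong (TScale 1 s) s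
  | cong_scaleDr a s t :
      cong (TScale a (TAdd s t)) (TAdd (TScale a s) (TScale a t))
  | cong_scaleDl a a' s :
      cong (TScale (a + a') s) (TAdd (TScale a s) (TScale a' s))
  | cong_mulC s t : cong (TMul s t) (TMul t s)
  | cong_mulA s t u : cong (TMul s (TMul t u)) (TMul (TMul s t) u)
  | cong_mulD s t u : cong (TMul (TAdd s t) u) (TAdd (TMul s u) (TMul t u))
  | cong_mulZ a s t : cong (TMul (TScale a s) t) (TScale a (TMul s t))
  | cong_RD s t : cong (TR (TAdd s t)) (TAdd (TR s) (TR t))
  | cong_RZ a s : cong (TR (TScale a s)) (TScale a (TR s))
  | cong_RB s t :
      cong (TMul (TR s) (TR t)) (TR (TAdd (TMul (TR s) t) (TMul s (TR t)))).

Record pres : Type := Pres {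
  pres_class : term -> Prop;
  pres_ex : exists t, pres_class = cong t }.

HB.instance Definition _ := gen_eqMixin pres.
HB.instance Definition _ := gen_choiceMixin pres.

Definition cl (t : term) : pres := Pres (ex_intro _ t erefl).
Definition rep (q : pres) : term := sval (cid (pres_ex q)).

Lemma cl_eq s t : cong s t -> cl s = cl t.
Proof.
move=> st; have E : cong s = cong t.
  apply/funext => u; apply/propext; split => H.
    exact: cong_trans (cong_sym st) H.
  exact: cong_trans st H.
rewrite /cl; move: (ex_intro _ s _) (ex_intro _ t _); rewrite E => p q.
by rewrite (Prop_irrelevance p q).
Qed.

Lemma cong_cl s t : cl s = cl t -> cong s t.
Proof. by case=> ->; apply: cong_refl. Qed.

Lemma repK q : cl (rep q) = q.
Proof.
rewrite /rep; case: cid => t /= E; case: q E => P p /= E.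
rewrite /cl; move: (ex_intro _ t _); rewrite -E => p'.
by rewrite (Prop_irrelevance p p').
Qed.

Lemma cong_rep t : cong (rep (cl t)) t.
Proof. by apply: cong_cl; rewrite repK. Qed.

Definition qadd p q := locked (cl (TAdd (rep p) (rep q))).
Definition qscale a p := locked (cl (TScale a (rep p))).
Definition qmul p q := locked (cl (TMul (rep p) (rep q))).
Definition qR p := locked (cl (TR (rep p))).

Lemma qaddE s t : qadd (cl s) (cl t) = cl (TAdd s t).
Proof. by rewrite /qadd -lock; apply/cl_eq/cong_add; apply: cong_rep. Qed.
Lemma qscaleE a s : qscale a (cl s) = cl (TScale a s).
Proof. by rewrite /qscale -lock; apply/cl_eq/cong_scale; apply: cong_rep. Qed.
Lemma qmulE s t : qmul (cl s) (cl t) = cl (TMul s t).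
Proof. by rewrite /qmul -lock; apply/cl_eq/cong_mul; apply: cong_rep. Qed.
Lemma qRE s : qR (cl s) = cl (TR s).
Proof. by rewrite /qR -lock; apply/cl_eq/cong_R; apply: cong_rep. Qed.

Definition qE := (qaddE, qscaleE, qmulE, qRE).

Lemma qaddA : associative qadd.
Proof.
move=> p q r; rewrite -(repK p) -(repK q) -(repK r) !qE.
by apply/cl_eq/cong_addA.
Qed.
Lemma qaddC : commutative qadd.
Proof. by move=> p q; rewrite -(repK p) -(repK q) !qE; apply/cl_eq/cong_addC. Qed.
Lemma qadd0 : left_id (cl TZero) qadd.
Proof. by move=> p; rewrite -(repK p) !qE; apply/cl_eq/cong_add0. Qed.
Lemma qaddN : left_inverse (cl TZero) (qscale (-1)) qadd.
Proof. by move=> p; rewrite -(repK p) !qE; apply/cl_eq/cong_addN. Qed.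

HB.instance Definition _ :=
  GRing.isZmodule.Build pres qaddA qaddC qadd0 qaddN.

Lemma qscaleA a a' p : qscale a (qscale a' p) = qscale (a * a') p.
Proof. by rewrite -(repK p) !qE; apply/cl_eq/cong_scaleA. Qed.
Lemma qscale1 : left_id 1 qscale.
Proof. by move=> p; rewrite -(repK p) !qE; apply/cl_eq/cong_scale1. Qed.
Lemma qscaleDr : right_distributive qscale +%R.
Proof.
move=> a p q; rewrite -(repK p) -(repK q) /GRing.add /= !qE.
exact/cl_eq/cong_scaleDr.
Qed.
Lemma qscaleDl p : {morph qscale^~ p : a a' / a + a'}.
Proof.
move=> a a'; rewrite -(repK p) [in RHS]/GRing.add /= !qE.
exact/cl_eq/cong_scaleDl.
Qed.

HB.instance Definition _ := GRing.Zmodule_isLmodule.Build k pres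
  qscaleA qscale1 qscaleDr qscaleDl.

Lemma presD s t : cl s + cl t = cl (TAdd s t). Proof. exact: qaddE. Qed.
Lemma presZ a s : a *: cl s = cl (TScale a s). Proof. exact: qscaleE. Qed.

Definition presE := (presD, presZ, qmulE, qRE).

Lemma qmulC : commutative qmul.
Proof. by move=> p q; rewrite -(repK p) -(repK q) !qE; apply/cl_eq/cong_mulC. Qed.

Lemma qmulA : associative qmul.
Proof.
move=> p q r; rewrite -(repK p) -(repK q) -(repK r) !presE.
by apply/cl_eq/cong_mulA.
Qed.

Lemma qmul_linearl q : linear (qmul^~ q).
Proof.
move=> a u v; rewrite /= -(repK q) -(repK u) -(repK v) !presE; apply: cl_eq.
apply: cong_trans (cong_mulD _ _ _) _; apply: cong_add; last exact: cong_refl.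
exact: cong_mulZ.
Qed.

Lemma qmul_linearr q : linear (qmul q).
Proof. by move=> a u v; rewrite 3!(qmulC q) (qmul_linearl q). Qed.

Definition pres_algebra : algebra k :=
  @Algebra k pres qmul qmul_linearl qmul_linearr.

Lemma qR_axiom : @rota_baxter k 0 pres_algebra qR.
Proof.
split=> [a u v|u v] /=.
  rewrite -(repK u) -(repK v) !presE; apply: cl_eq.
  apply: cong_trans (cong_RD _ _) _; apply: cong_add; last exact: cong_refl.
  exact: cong_RZ.
rewrite scale0r addr0 -(repK u) -(repK v) !presE.
exact/cl_eq/cong_RB.
Qed.

Definition pres_RB : comRBalg k :=
  @ComRBalg k pres_algebra qR qmulC qmulA qR_axiom.

Section Universal.
Variables (V : comRBalg k) (g : G -> V).

Fixpoint teval (t : term) : V :=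
  match t with
  | TGen x => g x
  | TZero => 0
  | TAdd s t => teval s + teval t
  | TScale a s => a *: teval s
  | TMul s t => amul (teval s) (teval t)
  | TR s => rbop (teval s)
  end.

Hypothesis grel : forall s t, rel s t -> teval s = teval t.

Lemma teval_cong s t : cong s t -> teval s = teval t.
Proof.
have lD (A : lmodType k) (f : A -> A) : linear f -> {morph f : x y / x + y}.
  by move=> lf x y; rewrite -{1}(scale1r x) lf scale1r.
have lZ (A : lmodType k) (f : A -> A) :
    linear f -> forall a, {morph f : x / a *: x}.
  move=> lf a x; have f0 : f 0 = 0.
    by apply: (addrI (f 0)); rewrite -lD // !addr0.
  by rewrite -[a *: x]addr0 lf f0 !addr0.
elim=> {s t} //=.
- by move=> s t u _ -> _ ->.
- by move=> s s' t t' _ -> _ ->.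
- by move=> a s s' _ ->.
- by move=> s s' t t' _ -> _ ->.
- by move=> s s' _ ->.
- by move=> s t u; rewrite addrA.
- by move=> s t; rewrite addrC.
- by move=> s; rewrite add0r.
- by move=> s; rewrite scaleN1r addNr.
- by move=> a a' s; rewrite scalerA.
- by move=> s; rewrite scale1r.
- by move=> a s t; rewrite scalerDr.
- by move=> a a' s; rewrite scalerDl.
- by move=> s t; rewrite rb_mulC.
- by move=> s t u; rewrite rb_mulA.
- by move=> s t u; rewrite (lD _ _ (amul_linearl (teval u))).
- by move=> a s t; rewrite (lZ _ _ (amul_linearl (teval t))).
- by move=> s t; rewrite (lD _ _ (rb_axiom V).1).
- by move=> a s; rewrite (lZ _ _ (rb_axiom V).1).
- by move=> s t; rewrite (rb_axiom V).2 scale0r addr0.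
Qed.

Definition pres_lift (q : pres_RB) : V := teval (rep q).

Lemma pres_liftE t : pres_lift (cl t) = teval t.
Proof. exact/teval_cong/cong_rep. Qed.

Lemma pres_lift_hom : rb_hom pres_lift.
Proof.
split; [split|] => [a u v|u v|u].
- by rewrite -(repK u) -(repK v) !presE !pres_liftE.
- by rewrite -(repK u) -(repK v) /= !presE !pres_liftE.
- by rewrite -(repK u) /= !presE !pres_liftE.
Qed.

Lemma pres_lift_uniq (f : pres_RB -> V) :
  rb_hom f -> (forall x, f (cl (TGen x)) = g x) -> f =1 pres_lift.
Proof.
move=> [[fl fM] fR] fg q; rewrite -(repK q) pres_liftE.
have f0 : f 0 = 0.
  by have /(addrI (f 0)) -> // : f 0 + f 0 = f 0 + 0;
     rewrite -{1}(scale1r (f 0)) -fl scale1r !addr0.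
elim: (rep q) => {q} /= [x||s <- t <-|a s <-|s <- t <-|s <-].
- exact: fg.
- exact: f0.
- by rewrite -[f (cl s)]scale1r -fl scale1r presD.
- by rewrite -[RHS]addr0 -f0 -fl addr0 presZ.
- by rewrite -fM /= qmulE.
- by rewrite -fR /= qRE.
Qed.

End Universal.
End Presentation.

Lemma free_comRB_exists (k : fieldType) (I : Type) :
  exists (F : comRBalg k) (iota : I -> F), free_comRB iota.
Proof.
pose rel (_ _ : term k I) := False.
exists (pres_RB rel), (fun i => cl rel (TGen k i)) => V g.
have grel s t : rel s t -> teval g s = teval g t by [].
exists (pres_lift g); split=> [|i|f'].
- exact: pres_lift_hom.
- exact: (pres_liftE grel).
- exact: pres_lift_uniq.
Qed.

Inductive env_rel (k : fieldType) (C : precomm k) :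
    term k C -> term k C -> Prop :=
  | env_linear a x y : env_rel (TGen k (a *: x + y))
      (TAdd (TScale a (TGen k x)) (TGen k y))
  | env_mul x y : env_rel (TGen k (amul x y))
      (TMul (TR (TGen k x)) (TGen k y)).

Lemma universal_envelope_exists (k : fieldType) (C : precomm k) :
  exists (U : comRBalg k) (phi : C -> derived U), universal_envelope phi.
Proof.
pose rel := @env_rel k C.
exists (pres_RB rel), (fun x => cl rel (TGen k x)); split.
  split=> [a x y|x y] /=.
    have E : a *: cl rel (TGen k x) + cl rel (TGen k y) =
        cl rel (TAdd (TScale a (TGen k x)) (TGen k y)) by rewrite presZ presD.
    by apply: etrans (esym E); apply/cl_eq/cong_rel/env_linear.
  by rewrite /dmul /= qRE qmulE; apply/cl_eq/cong_rel/env_mul.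
move=> V psi [psil psiM].
have grel s t : rel s t -> teval (psi : C -> V) s = teval (psi : C -> V) t.
  by case=> [a x y|x y] /=; [exact: psil | exact: psiM].
exists (pres_lift (psi : C -> V)); split=> [|x|f'].
- exact: pres_lift_hom.
- exact: (pres_liftE grel).
- exact: pres_lift_uniq.
Qed.

(* Main.v *)
(* R is inverted by a derivation, so an RB-algebra with injective R amounts to
   an algebra U, a subalgebra P = R(U) and a bijective derivation P -> U.
   Put A = k[B]/I and let H = k + C be the unital algebra with product
   c * c' = c > c' + c' > c on C. The axioms of C make A an H-algebra, the
   inclusion C -> A is a derivation of H, and the nonlinear part of A together
   with H is an H-stable complement G of its image in H + A. The derivation
   therefore extends to a surjection of H (x) Sh(G) onto (H + A) (x) Sh(G) with
   kernel k, where Sh is the shuffle algebra; inverting it turns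
   (H + A) (x) Sh(G) into a commutative RB-algebra containing C, in which
   differentiation gives coordinate functionals dual to the E-words.
   Conversely, R(b)m lies in k[B] and R(R(y)b) = R(y)R(b) - R(yR(b)), so the
   span of the E-words is closed under the operations. *)
Require Import Defs.
From HB Require Import structures.
From mathcomp Require Import all_boot all_order all_algebra ssrAC.
From mathcomp Require Import finmap monalg boolp functions.

Set Implicit Arguments.
Unset Strict Implicit.
Unset Printing Implicit Defensive.

Import GRing.Theory.

Local Open Scope ring_scope.

(** The identity R(c)R(d) = R(c > d + d > c) shows where H comes from: its augmentation ideal C
    stands for R(C), and its derivation R(c) -> c inverts R on C. An element outside the image of
    this derivation has no primitive yet, so iterated integrals over the complement G are adjoined
    freely, and products of iterated integrals are shuffles. Primitives are unique up to a scalar; R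
    picks the one whose scalar part at the empty word is 0. H-stability of G ensures that
    multiplying a letter by H creates no new part in the image of the derivation, so a primitive is
    found in closed form. The role of goodness becomes visible here: if R(x) is good for an E-word
    x, all coefficients of x lie in G, so R(x) has scalar coefficients and R(x)w still shows the
    monomial w. If x ends in a single letter, R(x) has coefficients in C, which act on w inside A
    and hide it. *)

Section LinearMap.
Variables (k : fieldType) (V W : lmodType k) (f : V -> W).
Hypothesis lf : linear f.

(** Maps are only known to be linear through a hypothesis; bundling them locally gives access to the
    library lemmas. *)
Definition linear_of : {linear V -> W} :=
  HB.pack f (GRing.isLinear.Build k V W *:%R f lf).

Lemma lin0 : f 0 = 0. Proof. exact: (linear0 linear_of). Qed.
Lemma linD x y : f (x + y) = f x + f y.
Proof. exact: (linearD linear_of). Qed.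
Lemma linB x y : f (x - y) = f x - f y.
Proof. exact: (linearB linear_of). Qed.
Lemma linZ a x : f (a *: x) = a *: f x.
Proof. exact: (linearZ_LR linear_of). Qed.
Lemma lin_sum (X : Type) (r : seq X) (P : pred X) F :
  f (\sum_(x <- r | P x) F x) = \sum_(x <- r | P x) f (F x).
Proof. exact: (linear_sum linear_of). Qed.

End LinearMap.

Lemma lin_comp (k : fieldType) (U V W : lmodType k) (f : V -> W) (g : U -> V) :
  linear f -> linear g -> linear (fun x => f (g x)).
Proof. by move=> lf lg a x y; rewrite lg lf. Qed.

Lemma lin_sub (k : fieldType) (V W : lmodType k) (f g : V -> W) :
  linear f -> linear g -> linear (fun x => f x - g x).
Proof. by move=> lf lg a x y; rewrite lf lg scalerBr opprD addrACA. Qed.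

Lemma lin_comb (k : fieldType) (V W : lmodType k) (f g : V -> W) (a : k) :
  linear f -> linear g -> linear (fun x => a *: f x + g x).
Proof.
move=> lf lg e x y; rewrite lf lg !scalerDr !scalerA (mulrC e) addrACA.
by [].
Qed.

Lemma lin_zero (k : fieldType) (V W : lmodType k) :
  linear (fun _ : V => 0 : W).
Proof. by move=> a x y; rewrite scaler0 addr0. Qed.

(** * Sums of finitely supported families *)

Section FiniteSum.
Variables (k : fieldType) (T : choiceType).
Implicit Types V W : lmodType k.

Definition finsup V (F : T -> V) : Prop :=
  exists L : {fset T}, forall x, x \notin L -> F x = 0.

(** Total, with default 0 on infinite supports, so that it can occur in definitions before
    finiteness is established. *)
Definition fsum V (F : T -> V) : V :=
  if pselect (finsup F) is left h then \sum_(x <- sval (cid h)) F x else 0.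

Lemma fsumE V (F : T -> V) (L : {fset T}) :
  (forall x, x \notin L -> F x = 0) -> fsum F = \sum_(x <- L) F x.
Proof.
move=> FL; rewrite /fsum; case: pselect => [h|[]]; last by exists L.
case: cid => K /= FK.
rewrite (big_fset_incl _ (fsubsetUl K L)); last by move=> x _ /FK.
by rewrite [RHS](big_fset_incl _ (fsubsetUr K L)) // => x _ /FL.
Qed.

Lemma finsup_lin V a (F F' : T -> V) :
  finsup F -> finsup F' -> finsup (fun x => a *: F x + F' x).
Proof.
move=> [L FL] [L' FL']; exists (L `|` L')%fset => x.
by rewrite in_fsetU negb_or => /andP[/FL-> /FL'->]; rewrite scaler0 addr0.
Qed.

Lemma fsum_lin V a (F F' : T -> V) : finsup F -> finsup F' ->
  fsum (fun x => a *: F x + F' x) = a *: fsum F + fsum F'.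
Proof.
move=> [L FL] [L' FL'].
have HL x : x \notin (L `|` L')%fset -> F x = 0.
  by rewrite in_fsetU negb_or => /andP[/FL].
have HL' x : x \notin (L `|` L')%fset -> F' x = 0.
  by rewrite in_fsetU negb_or => /andP[_ /FL'].
rewrite (fsumE HL) (fsumE HL') (@fsumE _ _ (L `|` L')%fset) => [|x xL].
  by rewrite big_split scaler_sumr.
by rewrite HL // HL' // scaler0 addr0.
Qed.

Lemma fsum0 V : fsum (fun _ : T => 0 : V) = 0.
Proof. by rewrite (@fsumE _ _ fset0) // big1. Qed.

Lemma finsupD V (F F' : T -> V) :
  finsup F -> finsup F' -> finsup (fun x => F x + F' x).
Proof.
move=> h h'; have := finsup_lin 1 h h'.
by congr finsup; apply/funext => x; rewrite scale1r.
Qed.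

Lemma fsumD V (F F' : T -> V) : finsup F -> finsup F' ->
  fsum (fun x => F x + F' x) = fsum F + fsum F'.
Proof.
move=> h h'; have := fsum_lin 1 h h'; rewrite scale1r => <-.
by congr fsum; apply/funext => x; rewrite scale1r.
Qed.

Lemma finsup_map V W (h : V -> W) (F : T -> V) :
  linear h -> finsup F -> finsup (fun x => h (F x)).
Proof. by move=> lh [L FL]; exists L => x /FL ->; apply: lin0. Qed.

Lemma fsum_map V W (h : V -> W) (F : T -> V) :
  linear h -> finsup F -> fsum (fun x => h (F x)) = h (fsum F).
Proof.
move=> lh [L FL]; rewrite (fsumE FL) (@fsumE _ _ L) => [|x /FL ->].
  by rewrite (lin_sum lh).
exact: lin0.
Qed.

Lemma fsum1 V (F : T -> V) y : (forall x, x != y -> F x = 0) -> fsum F = F y.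
Proof.
move=> Fy; rewrite (@fsumE _ _ [fset y]%fset) ?big_seq_fset1 // => x.
by rewrite in_fset1; apply: Fy.
Qed.

End FiniteSum.

(** * The shuffle product of series with coefficients in a commutative algebra *)

Section Shuffle.
Variables (k : fieldType) (G : choiceType) (A : algebra k).
Hypothesis mulC : commutative (@amul k A).
Hypothesis mulA : associative (@amul k A).
Implicit Types (w : seq G) (f g h : seq G -> A).

(* The coefficient at w of the shuffle product of the series f and g. *)
Fixpoint shuffle w f g : A :=
  if w is x :: v then
    shuffle v (fun u => f (x :: u)) g + shuffle v f (fun u => g (x :: u))
  else amul (f [::]) (g [::]).

Lemma shuffleC w f g : shuffle w f g = shuffle w g f.
Proof.
elim: w f g => [|x w IH] f g /=; first exact: mulC.
by rewrite addrC; congr (_ + _); apply: IH.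
Qed.

Lemma shuffle_linl w a f f' g :
  shuffle w (fun v => a *: f v + f' v) g =
  a *: shuffle w f g + shuffle w f' g.
Proof.
elim: w f f' g => [|x w IH] f f' g /=; first exact: (amul_linearl (g [::])).
by rewrite !IH scalerDr !addrA; congr (_ + _); rewrite addrAC.
Qed.

Lemma shuffle_linr w a f g g' :
  shuffle w f (fun v => a *: g v + g' v) =
  a *: shuffle w f g + shuffle w f g'.
Proof. by rewrite shuffleC shuffle_linl (shuffleC w g) (shuffleC w g'). Qed.

Lemma shuffleDl w f f' g :
  shuffle w (fun v => f v + f' v) g = shuffle w f g + shuffle w f' g.
Proof.
rewrite -[shuffle w f g]scale1r -shuffle_linl; congr shuffle.
by apply/funext => v; rewrite scale1r.
Qed.

Lemma shuffleDr w f g g' :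
  shuffle w f (fun v => g v + g' v) = shuffle w f g + shuffle w f g'.
Proof. by rewrite shuffleC shuffleDl (shuffleC w g) (shuffleC w g'). Qed.

Lemma shuffle0r w f : shuffle w f (fun _ => 0) = 0.
Proof.
elim: w f => [|x w IH] f /=; last by rewrite !IH addr0.
exact: (lin0 (amul_linearr _)).
Qed.

Lemma shuffleA w f g h :
  shuffle w f (fun v => shuffle v g h) = shuffle w (fun v => shuffle v f g) h.
Proof.
elim: w f g h => [|x w IH] f g h /=; first exact: mulA.
by rewrite shuffleDl shuffleDr !IH addrA.
Qed.

Lemma shuffle_const w f u :
  shuffle w f (fun v => if v is [::] then u else 0) = amul (f w) u.
Proof. by elim: w f => [|x w IH] f //=; rewrite IH shuffle0r addr0. Qed.

Lemma shuffle_closed (P : A -> Prop) w f g :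
  (forall x y, P x -> P y -> P (x + y)) ->
  (forall x y, P x -> P y -> P (amul x y)) ->
  (forall v, P (f v)) -> (forall v, P (g v)) -> P (shuffle w f g).
Proof.
move=> PD PM; elim: w f g => [|x w IH] f g Pf Pg /=; first exact: PM.
by apply: PD; apply: IH => v.
Qed.

(** Every term of the shuffle is a single product of a value of [f] and a value of [g]. The
    predicate [P] is there because the derivation of the model satisfies the Leibniz rule on a
    subalgebra only. *)
Lemma shuffle_derivation (P : A -> Prop) (D : A -> A) w f g :
  linear D ->
  (forall x y, P x -> P y -> D (amul x y) = amul (D x) y + amul x (D y)) ->
  (forall v, P (f v)) -> (forall v, P (g v)) ->
  D (shuffle w f g) =
    shuffle w (fun v => D (f v)) g + shuffle w f (fun v => D (g v)).
Proof.
move=> lD DM; elim: w f g => [|x w IH] f g Pf Pg /=; first exact: DM.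
by rewrite (linD lD) !IH // addrACA.
Qed.

Lemma shuffle_finsup w (F : G -> seq G -> A) g :
  (forall v, finsup (F^~ v)) -> finsup (fun x => shuffle w (F x) g).
Proof.
elim: w F g => [|y w IH] F g FF /=.
  exact: (finsup_map (amul_linearl (g [::]))).
by apply: finsupD; apply: IH => v; apply: FF.
Qed.

Lemma shuffle_fsum w (F : G -> seq G -> A) g :
  (forall v, finsup (F^~ v)) ->
  shuffle w (fun v => fsum (F^~ v)) g = fsum (fun x => shuffle w (F x) g).
Proof.
elim: w F g => [|y w IH] F g FF /=.
  by rewrite (fsum_map (amul_linearl (g [::]))).
rewrite fsumD ?(IH (fun x v => F x (y :: v))) ?IH //.
  by apply: shuffle_finsup => v.
by apply: shuffle_finsup => v.
Qed.

(** The coefficient at [w] only reads values at words no longer than [w]. *)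
Lemma shuffle_eq0 w f g :
  (forall u, (size u <= size w)%N -> f u = 0) -> shuffle w f g = 0.
Proof.
elim: w f g => [|x w IH] f g f0 /=.
  by rewrite f0 //; apply: (lin0 (amul_linearl _)).
rewrite !IH ?addr0 // => u uw; apply: f0 => //=.
exact: leqW.
Qed.

Lemma shuffle_letters (L : {fset G}) n w f g :
  (forall u, (size u <= n)%N -> ~~ all (mem L) u -> f u = 0) ->
  (forall u, (size u <= n)%N -> ~~ all (mem L) u -> g u = 0) ->
  (size w <= n)%N -> ~~ all (mem L) w -> shuffle w f g = 0.
Proof.
elim: w n f g => [//|x w IH] [//|n] f g f0 g0 /= wn; rewrite negb_and.
have fx u : (size u <= n)%N -> ~~ all (mem L) (x :: u) -> f (x :: u) = 0.
  by move=> un; apply: f0.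
have gx u : (size u <= n)%N -> ~~ all (mem L) (x :: u) -> g (x :: u) = 0.
  by move=> un; apply: g0.
have [xL /= wL|xL _] := boolP (x \in L).
  rewrite (IH n (fun u => f (x :: u))) // ?add0r => [|u un uL|u un uL].
  - apply: (IH n) => // u un uL; first exact: f0 (leqW un) uL.
    by apply: gx => //=; rewrite negb_and uL orbT.
  - by apply: fx => //=; rewrite negb_and uL orbT.
  - exact: g0 (leqW un) uL.
(* A first letter outside [L] goes to one of the two factors, which then vanishes at all the lengths
   that matter. *)
rewrite (shuffleC _ f) !shuffle_eq0 ?addr0 // => u uw.
  by apply: gx; rewrite ?(leq_trans uw) //= negb_and xL.
by apply: fx; rewrite ?(leq_trans uw) //= negb_and xL.
Qed.

End Shuffle.

(** * Series supported, up to each length, on words over a finite alphabet *)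

Section Series.
Variables (k : fieldType) (G : choiceType) (V : lmodType k).

(* This makes the rows x |-> f (x :: w) finitely supported, so that they can
   be summed, and it is preserved by shuffle, sdiff and sint; finiteness of the
   rows alone would not survive sdiff. *)
Definition lengthwise_finite : {pred seq G -> V} :=
  fun f => `[< forall n, exists L : {fset G}, forall w,
    (size w <= n)%N -> ~~ all (mem L) w -> f w = 0 >].

Lemma not_all_subset (L L' : {fset G}) (w : seq G) :
  (L `<=` L')%fset -> ~~ all (mem L') w -> ~~ all (mem L) w.
Proof.
move=> /fsubsetP LL'; apply: contra => /allP wL.
by apply/allP => x xw; apply/LL'/wL.
Qed.

Lemma lengthwise_finite_submod : submod_closed lengthwise_finite.
Proof.
split; first by apply/asboolP => n; exists fset0.
move=> a f g /asboolP ff /asboolP fg; apply/asboolP => n.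
have [[L fL] [L' gL']] := (ff n, fg n); exists (L `|` L')%fset => w wn wL.
rewrite /= !fctE fL ?gL' ?scaler0 ?addr0 //; apply: not_all_subset wL.
  exact: fsubsetUr.
exact: fsubsetUl.
Qed.

HB.instance Definition _ := GRing.isSubmodClosed.Build k (seq G -> V)
  lengthwise_finite lengthwise_finite_submod.

Record series := Series {
  coef :> seq G -> V;
  _ : coef \in lengthwise_finite }.

HB.instance Definition _ := [isSub for coef].
HB.instance Definition _ := [Choice of series by <:].
HB.instance Definition _ := [SubChoice_isSubLmodule of series by <:].

Lemma coef_letters (f : series) n : exists L : {fset G}, forall w,
  (size w <= n)%N -> ~~ all (mem L) w -> f w = 0.
Proof. by case: f => f /= /asboolP; apply. Qed.

Lemma coef_finsup (f : series) w : finsup (fun x => f (x :: w)).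
Proof.
have [L fL] := coef_letters f (size w).+1; exists L => x xL.
by apply: fL => //=; rewrite (negbTE xL).
Qed.

Lemma seriesP (f g : series) : f =1 g -> f = g.
Proof. by move=> fg; apply: val_inj; apply/funext. Qed.

Lemma coef_lin a (f g : series) w : (a *: f + g) w = a *: f w + g w.
Proof. by []. Qed.

Definition mkseries (f : seq G -> V)
  (ff : forall n, exists L : {fset G}, forall w,
    (size w <= n)%N -> ~~ all (mem L) w -> f w = 0) : series :=
  Series (asboolT ff).

End Series.

(** Only finitely many words of length at most [n] have all letters in [L], so their supports have a
    finite union. *)
Lemma finsup_words (k : fieldType) (G T : choiceType) (V : lmodType k)
    (L : {fset G}) n (F : seq G -> T -> V) : (forall w, finsup (F w)) ->
  exists K : {fset T}, forall w x,
    (size w <= n)%N -> all (mem L) w -> x \notin K -> F w x = 0.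
Proof.
elim: n F => [|n IH] F FF.
  by have [K FK] := FF [::]; exists K => -[|//] x _ _; apply: FK.
have [K0 FK0] := FF [::].
pose K y := sval (cid (IH (fun w => F (y :: w)) (fun w => FF (y :: w)))).
exists (K0 `|` \bigcup_(y <- L) K y)%fset => -[|y w] x /=.
  by move=> _ _; rewrite in_fsetU negb_or => /andP[/FK0].
rewrite ltnS => wn /andP[yL wL]; rewrite in_fsetU negb_or => /andP[_ xK].
apply: (svalP (cid (IH (fun w => F (y :: w)) (fun w => FF (y :: w))))) => //.
by apply: contra xK => xK; apply/bigfcupP; exists y; rewrite ?yL.
Qed.

(* The letters x, embedded by e, form a basis of a complement of del(H), and
   co, sig are the coordinates along this decomposition. *)
Record shuffle_datum (k : fieldType) (G : choiceType) := ShuffleDatum {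
  sd_alg :> algebra k;
  sd_mulC : commutative (@amul k sd_alg);
  sd_mulA : associative (@amul k sd_alg);
  sd_one : sd_alg;
  sd_mul1 : left_id sd_one (@amul k sd_alg);
  sd_H : sd_alg -> Prop;
  sd_H_lin : forall a u v, sd_H u -> sd_H v -> sd_H (a *: u + v);
  sd_H_mul : forall u v, sd_H u -> sd_H v -> sd_H (amul u v);
  sd_H_one : sd_H sd_one;
  sd_eps : sd_alg -> k^o;
  sd_eps_lin : linear sd_eps;
  sd_del : sd_alg -> sd_alg;
  sd_del_lin : linear sd_del;
  sd_del_one : sd_del sd_one = 0;
  sd_del_mul : forall u v, sd_H u -> sd_H v ->
    sd_del (amul u v) = amul (sd_del u) v + amul u (sd_del v);
  sd_sig : sd_alg -> sd_alg;
  sd_sig_lin : linear sd_sig;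
  sd_sig_H : forall u, sd_H (sd_sig u);
  sd_sig_del : forall u, sd_H u -> sd_sig (sd_del u) = u - sd_eps u *: sd_one;
  sd_eps_sig : forall u, sd_eps (sd_sig u) = 0;
  sd_eps_sigM : forall u v, sd_eps (amul (sd_sig u) (sd_sig v)) = 0;
  sd_e : G -> sd_alg;
  sd_e_free : forall a : G -> k^o, finsup a ->
    fsum (fun x => a x *: sd_e x) = 0 -> forall x, a x = 0;
  sd_sig_e : forall u x, sd_H u -> sd_sig (amul u (sd_e x)) = 0;
  sd_co : G -> sd_alg -> k^o;
  sd_co_lin : forall x, linear (sd_co x);
  sd_co_fin : forall u, finsup (sd_co^~ u);
  sd_co_sum : forall u,
    fsum (fun x => sd_co x u *: sd_e x) = u - sd_del (sd_sig u) }.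

(** * The Rota-Baxter algebra of series attached to a shuffle datum *)

Section SeriesRB.
Variables (k : fieldType) (G : choiceType) (D : shuffle_datum k G).

Notation one := (sd_one D).
Notation H := (@sd_H _ _ D).
Notation del := (@sd_del _ _ D).
Notation sig := (@sd_sig _ _ D).
Notation eps := (@sd_eps _ _ D).
Notation e := (@sd_e _ _ D).
Notation co := (@sd_co _ _ D).
Notation N := (series G D).
Implicit Types (f g : N) (w : seq G).

Let mulC := @sd_mulC _ _ D.
Let mulA := @sd_mulA _ _ D.

Lemma sd_H0 : H 0.
Proof.
have := sd_H_lin (-1) (sd_H_one D) (sd_H_one D).
by rewrite scaleN1r addNr.
Qed.

Lemma sd_HD u v : H u -> H v -> H (u + v).
Proof. by move=> Hu Hv; rewrite -[u]scale1r; apply: sd_H_lin. Qed.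

Lemma sd_HZ a u : H u -> H (a *: u).
Proof. by move=> Hu; rewrite -[a *: u]addr0; apply: sd_H_lin sd_H0. Qed.

Lemma smul_finite f g n : exists L : {fset G}, forall w,
  (size w <= n)%N -> ~~ all (mem L) w -> shuffle w f g = 0.
Proof.
have [[L fL] [L' gL]] := (coef_letters f n, coef_letters g n).
exists (L `|` L')%fset => w; apply: (shuffle_letters mulC) => u un uL.
  by apply: fL => //; apply: not_all_subset uL; apply: fsubsetUl.
by apply: gL => //; apply: not_all_subset uL; apply: fsubsetUr.
Qed.

Definition smul f g : N := mkseries (smul_finite f g).

Lemma smulE f g w : smul f g w = shuffle w f g.
Proof. by []. Qed.

Lemma smulC : commutative smul.
Proof. by move=> f g; apply: seriesP => w; apply: (shuffleC mulC). Qed.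

Lemma smulA : associative smul.
Proof. by move=> f g h; apply: seriesP => w; apply: (shuffleA mulC mulA). Qed.

Lemma smul_linearl g : linear (smul^~ g).
Proof. by move=> a f f'; apply: seriesP => w; apply: shuffle_linl. Qed.

Lemma smul_linearr f : linear (smul f).
Proof. by move=> a g g'; apply: seriesP => w; apply: (shuffle_linr mulC). Qed.

Definition series_alg : algebra k := Algebra smul_linearl smul_linearr.

(* The tensor u (x) x1...xn is encoded as the series with coefficient u at
   [:: x1; ...; xn], so sdiff maps h (x) x w to del h (x) x w + h e(x) (x) w. *)
Definition sdiff (f : seq G -> D) w : D :=
  del (f w) + fsum (fun x => amul (f (x :: w)) (e x)).

Lemma sdiff_finite f n : exists L : {fset G}, forall w,
  (size w <= n)%N -> ~~ all (mem L) w -> sdiff f w = 0.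
Proof.
have [L fL] := coef_letters f n.+1; exists L => w wn wL.
rewrite /sdiff fL ?leqW // (lin0 (@sd_del_lin _ _ _)) add0r.
rewrite -[RHS](fsum0 G D); congr fsum; apply/funext => x.
by rewrite fL ?(lin0 (amul_linearl _)) //= negb_and wL orbT.
Qed.

Definition sdiff_series f : N := mkseries (sdiff_finite f).

Lemma sdiff_fin f w : finsup (fun x => amul (f (x :: w)) (e x)).
Proof.
have [L fL] := coef_finsup f w; exists L => x /fL ->.
exact: lin0 (amul_linearl _).
Qed.

Lemma sdiff_lin a f g w : sdiff (a *: f + g) w = a *: sdiff f w + sdiff g w.
Proof.
rewrite /sdiff coef_lin (@sd_del_lin _ _ D) scalerDr addrACA -fsum_lin;
  try exact: sdiff_fin.
congr (_ + fsum _); apply/funext => x.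
by rewrite coef_lin (amul_linearl (e x)).
Qed.

Lemma shuffle_mulr w (f g : seq G -> D) u :
  amul (shuffle w f g) u = shuffle w (fun v => amul (f v) u) g.
Proof.
elim: w f g => [|x w IH] f g /=.
  by rewrite -!mulA (mulC (g [::])).
by rewrite (linD (amul_linearl u)) !IH.
Qed.

(** Both summands of [sdiff] obey the Leibniz rule: [del] is a derivation on H, and removing the
    first letter is a derivation of the shuffle product. *)
Lemma sdiff_mul f g w : (forall v, H (f v)) -> (forall v, H (g v)) ->
  sdiff (smul f g) w = shuffle w (sdiff f) g + shuffle w f (sdiff g).
Proof.
move=> Hf Hg; rewrite /sdiff smulE.
rewrite (shuffle_derivation w (@sd_del_lin _ _ D) (@sd_del_mul _ _ D) Hf Hg).
rewrite shuffleDl (shuffleDr mulC) addrACA; congr (_ + _).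
have fin f' g' : finsup (fun x => shuffle w (fun v => amul (f' (x :: v)) (e x))
  g').
  by apply: shuffle_finsup => v; apply: (sdiff_fin f').
rewrite (shuffleC mulC w f) !(@shuffle_fsum _ _ D _
  (fun x v => amul ((_ : N) (x :: v)) (e x)));
  try by move=> v; apply: sdiff_fin.
rewrite -fsumD; try exact: fin.
congr fsum; apply/funext => x; rewrite smulE /= (linD (amul_linearl _)).
by rewrite shuffle_mulr (shuffleC mulC w f) shuffle_mulr.
Qed.

(** The subtracted sum is what the values [sig (f (y :: w))] of the primitive contribute to its
    derivative at [w]. The rest has to come from [del] and from scalars at the words [x :: w]. *)
Definition sprim (f : seq G -> D) w : D :=
  f w - fsum (fun y => amul (sig (f (y :: w))) (e y)).

(* A right inverse of sdiff, because u - del (sig u) and sig u * e x both lie in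
   the span of the letters. *)
Definition sint (f : seq G -> D) w : D :=
  sig (f w) + if w is x :: v then co x (sprim f v) *: one else 0.

Lemma sig_fin f w : finsup (fun y => amul (sig (f (y :: w))) (e y)).
Proof.
apply: (finsup_map (h := idfun)) => //; have [L fL] := coef_finsup f w.
exists L => x /fL ->; rewrite (lin0 (@sd_sig_lin _ _ _)).
exact: lin0 (amul_linearl _).
Qed.

Lemma sprim_lin a f g w : sprim (a *: f + g) w = a *: sprim f w + sprim g w.
Proof.
rewrite /sprim coef_lin scalerBr addrACA -opprD; congr (_ - _).
rewrite -fsum_lin; try exact: sig_fin.
congr fsum; apply/funext => x.
by rewrite coef_lin (@sd_sig_lin _ _ D) (amul_linearl (e x)).
Qed.

Lemma sint_finite f n : exists L : {fset G}, forall w,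
  (size w <= n)%N -> ~~ all (mem L) w -> sint f w = 0.
Proof.
have [L fL] := coef_letters f n.+1.
(* The scalars in [sint] may sit at first letters outside [L]; [K] collects those that occur in
   front of words over [L]. *)
have [K fK] := finsup_words L n (fun w => sd_co_fin (sprim f w)).
exists (L `|` K)%fset => w wn wLK.
have wL : ~~ all (mem L) w by apply: not_all_subset wLK; apply: fsubsetUl.
rewrite /sint fL ?leqW // (lin0 (@sd_sig_lin _ _ _)) add0r.
case: w wn wLK wL => [//|x w] /= wn wLK wL.
have [wL'|wL'] := boolP (all (mem L) w); last first.
  rewrite /sprim fL //; last by rewrite ltnW // ltnW.
  rewrite (_ : fsum _ = 0) ?subr0 ?(lin0 (@sd_co_lin _ _ _ _)) ?scale0r //.
  rewrite -[RHS](fsum0 G D); congr fsum; apply/funext => y.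
  rewrite fL ?(lin0 (@sd_sig_lin _ _ _)) ?(lin0 (amul_linearl _)) //.
    exact: leqW.
  by rewrite /= negb_and wL' orbT.
rewrite fK ?scale0r //; first exact: ltnW.
have xL : x \notin L by apply: contra wL => /= ->.
apply: contra wLK => xK; rewrite in_fsetU xK orbT /=.
by apply/allP => y yw; apply/fsetUP; left; apply: (allP wL').
Qed.

Definition srb f : N := mkseries (sint_finite f).

Lemma srbE f w : srb f w = sint f w.
Proof. by []. Qed.

Lemma srb_linear : linear srb.
Proof.
move=> a f g; apply: seriesP => w; rewrite coef_lin !srbE /sint.
rewrite coef_lin (@sd_sig_lin _ _ D) scalerDr addrACA; congr (_ + _).
case: w => [|x w]; first by rewrite scaler0 addr0.
by rewrite sprim_lin (@sd_co_lin _ _ D) scalerDl scalerA.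
Qed.

Lemma sint_H f w : H (sint f w).
Proof.
apply: sd_HD; first exact: sd_sig_H.
by case: w => [|x w]; [apply: sd_H0 | apply: sd_HZ (sd_H_one D)].
Qed.

Lemma sdiffK f w : sdiff (srb f) w = f w.
Proof.
have dZ a : del (a *: one) = 0.
  by rewrite (linZ (@sd_del_lin _ _ _)) sd_del_one scaler0.
rewrite /sdiff srbE {1}/sint (linD (@sd_del_lin _ _ _)).
rewrite (_ : del (if _ is _ :: _ then _ else _) = 0) ?addr0; last first.
  by case: w => [|x w]; rewrite ?dZ ?(lin0 (@sd_del_lin _ _ _)).
have -> : fsum (fun x => amul (srb f (x :: w)) (e x)) =
    fsum (fun x => amul (sig (f (x :: w))) (e x)) +
    fsum (fun x => co x (sprim f w) *: e x).
  rewrite -fsumD; first last.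
  - by have [L hL] := sd_co_fin (sprim f w); exists L => x /hL ->;
      rewrite scale0r.
  - exact: sig_fin.
  congr fsum; apply/funext => x.
  by rewrite srbE /sint (linD (amul_linearl _)) (linZ (amul_linearl _)) sd_mul1.
rewrite sd_co_sum /sprim.
(* By H-stability of the span of the letters, [sprim f w] and [f w] have the same image under [sig],
   and the two [del] terms cancel. *)
have sig0 : sig (fsum (fun y => amul (sig (f (y :: w))) (e y))) = 0.
  rewrite -(fsum_map (@sd_sig_lin _ _ D)); last exact: sig_fin.
  rewrite -[RHS](fsum0 G D); congr fsum; apply/funext => y.
  exact: sd_sig_e (sd_sig_H _).
rewrite (linB (@sd_sig_lin _ _ D)) sig0 subr0.
by rewrite addrC addrA subrK addrC subrK.
Qed.

(** Applying [sig] to the vanishing derivative leaves only scalar coefficients. The derivative is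
    then a combination of letters, whose freeness kills the scalars at nonempty words; the last one
    is killed by [eps]. *)
Lemma sdiff_inj f : (forall w, H (f w)) -> (forall w, sdiff f w = 0) ->
  eps (f [::]) = 0 -> f = 0.
Proof.
move=> Hf df f0.
have fe w : f w = eps (f w) *: one.
  apply/eqP; rewrite -subr_eq0 -sd_sig_del //; apply/eqP.
  have := df w; rewrite /sdiff => /(congr1 sig).
  rewrite (lin0 (@sd_sig_lin _ _ _)) (linD (@sd_sig_lin _ _ _)).
  rewrite -(fsum_map (@sd_sig_lin _ _ D)); last exact: sdiff_fin.
  rewrite (_ : (fun x => _) = fun _ => 0) ?fsum0 ?addr0 //.
  by apply/funext => x; apply: sd_sig_e.
have ef x w : eps (f (x :: w)) = 0.
  move: x; apply: (@sd_e_free _ _ D).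
    exact: (finsup_map (@sd_eps_lin _ _ D) (coef_finsup f w)).
  have := df w; rewrite /sdiff fe (linZ (@sd_del_lin _ _ _)) sd_del_one.
  rewrite scaler0 add0r => <-; congr fsum; apply/funext => x.
  by rewrite [in RHS]fe (linZ (amul_linearl _)) sd_mul1.
by apply: seriesP => -[|x w]; rewrite fe ?f0 ?ef scale0r.
Qed.

(** Both sides are H-valued, have the same derivative by the Leibniz rule and [sdiffK], and have
    [eps] equal to 0 at the empty word, so [sdiff_inj] identifies them. *)
Lemma srb_axiom : @rota_baxter k 0 series_alg srb.
Proof.
split; first exact: srb_linear.
move=> f g; rewrite scale0r addr0; apply/eqP; rewrite -subr_eq0; apply/eqP.
have subE (u v : N) : u - v = (-1) *: v + u by rewrite scaleN1r addrC.
have HM u v w : H (smul (srb u) (srb v) w).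
  apply: shuffle_closed => [x y|x y|w'|w'].
  - exact: sd_HD.
  - exact: sd_H_mul.
  - exact: sint_H.
  - exact: sint_H.
rewrite subE; apply: sdiff_inj => [w|w|].
- by rewrite coef_lin; apply: sd_H_lin => //; apply: sint_H.
- rewrite sdiff_lin sdiffK sdiff_mul; try by move=> v; apply: sint_H.
  rewrite -[X in -1 *: X]/(shuffle w (srb f) g + shuffle w f (srb g)).
  rewrite scaleN1r addrC; apply/eqP; rewrite subr_eq0; apply/eqP;
    rewrite addrC; congr (_ + _).
    by congr shuffle; apply/funext => v; rewrite sdiffK.
  by congr shuffle; apply/funext => v; rewrite sdiffK.
- have e0 u : eps (srb u [::]) = 0 by rewrite srbE /sint addr0 sd_eps_sig.
  have e1 : eps (amul (srb f [::]) (srb g [::])) = 0.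
    by rewrite !srbE /sint !addr0 sd_eps_sigM.
  by rewrite coef_lin (@sd_eps_lin _ _ D) e0 scaler0 add0r.
Qed.

Definition series_RB :
  comRBalg k := @ComRBalg k series_alg srb smulC smulA srb_axiom.

End SeriesRB.

(** * Semidirect products of commutative algebras *)

Section Semidirect.
Variables (k : fieldType) (B M : algebra k) (act : B -> M -> M).
Hypothesis BC : commutative (@amul k B).
Hypothesis BA : associative (@amul k B).
Hypothesis MC : commutative (@amul k M).
Hypothesis MA : associative (@amul k M).
Hypothesis act_linl : forall m, linear (act^~ m).
Hypothesis act_linr : forall r, linear (act r).
Hypothesis actA : forall r s m, act r (act s m) = act (amul r s) m.
Hypothesis act_mul : forall r m n, act r (amul m n) = amul (act r m) n.

Definition sdmul (u v : (B * M)%type) : (B * M)%type :=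
  (amul u.1 v.1, act u.1 v.2 + act v.1 u.2 + amul u.2 v.2).

Lemma sdmulC : commutative sdmul.
Proof.
by move=> u v; rewrite /sdmul BC MC; congr (_, _ + _); rewrite addrC.
Qed.

Lemma sdmul_linearl v : linear (sdmul^~ v).
Proof.
move=> a u u'; congr (_, _); first exact: amul_linearl.
rewrite /= (act_linl v.2) (act_linr v.1) (amul_linearl v.2) !scalerDr.
by rewrite [RHS](AC (3*3) ((1*4)*(2*5)*(3*6))).
Qed.

Lemma sdmul_linearr u : linear (sdmul u).
Proof. by move=> a v v'; rewrite 3!(sdmulC u) sdmul_linearl. Qed.

Lemma sdmulA : associative sdmul.
Proof.
move=> [r m] [s n] [t l]; rewrite /sdmul /=; congr (_, _); first exact: BA.
rewrite !(linD (act_linr _)) (linD (amul_linearl _)) (linD (amul_linearl _)).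
rewrite !(linD (amul_linearr _)) !actA !act_mul MA (MC m (act s l)).
rewrite (MC m (act t n)) -!act_mul (MC l) (MC n m) (BC t s) (BC t r).
by rewrite [LHS](AC (3*1*3) (1*(2*4*6)*(3*5*7))).
Qed.

Definition semidirect : algebra k := Algebra sdmul_linearl sdmul_linearr.

End Semidirect.

(** * Linear extension from monomials, and bases modulo a subspace *)

HB.lock Definition lext (k : fieldType) (K : choiceType) (V : lmodType k)
    (h : K -> V) (p : {malg k[K]}) : V :=
  \sum_(m <- msupp p) p@_m *: h m.

Section Extension.
Variables (k : fieldType) (K : choiceType) (V : lmodType k).
Implicit Types (p q : {malg k[K]}) (h : K -> V).

Lemma malg_sum p : p = \sum_(m <- msupp p) p@_m *: << m >>.
Proof.
rewrite {1}[p]monalgE; apply: eq_bigr => m _.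
by apply/malgP => m'; rewrite mcoeffZ !mcoeffU mulrb mulr_natr mulrb.
Qed.

Lemma lextEw h p (L : {fset K}) : (msupp p `<=` L)%fset ->
  lext h p = \sum_(m <- L) p@_m *: h m.
Proof.
move=> pL; rewrite lext.unlock (big_fset_incl _ pL) // => m _ mp.
by rewrite mcoeff_outdom // scale0r.
Qed.

Lemma lext_lin h : linear (lext h).
Proof.
move=> a p q; pose L := (msupp p `|` msupp q)%fset.
have pL : (msupp p `<=` L)%fset by apply: fsubsetUl.
have qL : (msupp q `<=` L)%fset by apply: fsubsetUr.
have sL : (msupp (a *: p + q) `<=` L)%fset.
  apply: fsubset_trans (msuppD_le _ _) _; apply: fsetUSS => //.
  exact: msuppZ_le.
rewrite (lextEw _ pL) (lextEw _ qL) (lextEw _ sL) scaler_sumr -big_split.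
by apply: eq_bigr => m _; rewrite mcoeffD mcoeffZ scalerDl scalerA.
Qed.

Lemma lextU h m : lext h << m >> = h m.
Proof.
by rewrite lext.unlock msuppU oner_eq0 big_seq_fset1 mcoeffUU scale1r.
Qed.

Lemma eq_linear (f g : {malg k[K]} -> V) p : linear f -> linear g ->
  (forall m, m \in msupp p -> f << m >> = g << m >>) -> f p = g p.
Proof.
move=> lf lg fg; rewrite [p]malg_sum (lin_sum lf) (lin_sum lg).
rewrite big_seq [RHS]big_seq; apply: eq_bigr => m mp.
by rewrite (linZ lf) (linZ lg) fg.
Qed.

End Extension.

Section BasisMod.
Variables (k : fieldType) (V : lmodType k) (D W : V -> Prop).
Variables (X : choiceType) (P : X -> Prop) (e : X -> V).
Hypothesis bas : basis_mod D W P e.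

Lemma basis_mod_free (q : {malg k[X]}) :
  (forall x, x \in msupp q -> P x) -> W (lext e q) -> q = 0.
Proof.
move=> qP Wq; have [_ free _] := bas.
pose x := tnth (in_tuple (msupp q)).
have xq i : x i \in msupp q by apply: mem_tnth.
have x_inj : injective x by apply/tuple_uniqP/fset_uniq.
have q0 := free _ x (fun i => q@_(x i)) x_inj (fun i => qP _ (xq i)).
apply/malgP => m; rewrite mcoeff0; case: (msuppP q m) => // mq.
have /tnthP[i ->] : m \in in_tuple (msupp q) by [].
by apply: q0; rewrite /combination; rewrite lext.unlock big_tnth in Wq.
Qed.

Lemma basis_mod_gen v : D v ->
  exists q : {malg k[X]}, (forall x, x \in msupp q -> P x) /\ W (v - lext e q).
Proof.
have [_ _ gen] := bas => /gen[n [x [c [xP Wv]]]].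
exists (combination (fun x => << x >>) x c); split=> [y|].
  rewrite /combination; case: (pselect (P y)) => // yP.
  rewrite -mcoeff_neq0 raddf_sum big1 ?eqxx // => i _ /=;
    rewrite mcoeffZ mcoeffU mulrb.
  case: eqP => [xy|]; last by rewrite mulr0.
  by case: yP; rewrite -xy; apply: xP.
rewrite /combination (lin_sum (lext_lin e)).
under eq_bigr => i _ do rewrite (linZ (lext_lin e)) lextU.
exact: Wv.
Qed.

End BasisMod.

(** * Splitting a letter off a commutative monomial *)

Section Monomials.
Variable I : choiceType.
Implicit Types (m : {cmonom I}) (i : I).

Lemma cmonom_split m : m != mone -> exists p, m = mmul (ucm p.1) p.2.
Proof.
move=> m1; have [i im] : exists i, i \in finsupp m.
  apply/fset0Pn; apply: contra m1 => /eqP m0; apply/cmP => i.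
  by rewrite cm1; apply/eqP; rewrite cmE_eq0 m0.
exists (i, divcm m (ucm i)); apply/eqP/cmP => j /=.
rewrite cmM divcmE cmU; case: eqP => [<-|_]; last by rewrite subn0.
by rewrite subnKC // lt0n cmE_neq0.
Qed.

(** An arbitrary choice of a letter dividing [m]. The action of R(c) defined through it depends on
    the choice, but only modulo the ideal. *)
Definition head_letter m : option (I * {cmonom I}) :=
  if pselect (exists p, m = mmul (ucm p.1) p.2) is left h
  then Some (sval (cid h)) else None.

Lemma head_letterP m : m != mone ->
  exists i m', m = mmul (ucm i) m' /\ head_letter m = Some (i, m').
Proof.
move=> /cmonom_split h; rewrite /head_letter; case: pselect => // h'.
by case: cid => -[i m'] /= E; exists i, m'.
Qed.

Lemma head_letter1 : head_letter mone = None.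
Proof.
rewrite /head_letter; case: pselect => // h; exfalso; case: h => p /esym/eqP.
by rewrite cmM_eq1 cm1_eq1.
Qed.

Lemma ucm_inj : injective (@ucm I).
Proof.
move=> i j E; have := congr1 (fun m : {cmonom I} => m j) E.
by rewrite cmUU cmU; case: eqP.
Qed.

Lemma mmul_inj m : injective (mmul m).
Proof.
move=> m1 m2 E; apply/eqP/cmP => i.
have := congr1 (fun m' : {cmonom I} => m' i) E.
by rewrite !cmM => /addnI.
Qed.

Lemma mdeg1P m : reflect (exists i, m = ucm i) (mdeg m == 1)%N.
Proof.
apply: (iffP eqP) => [m1|[i ->]]; last exact: mdegU.
have /cmonom_split[[i m'] /= E] : m != mone.
  by apply: contra_eqN m1 => /eqP ->; rewrite mdeg1.
move: m1; rewrite E mdegM mdegU => -[/mdeg_eq0I ->].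
by exists i; rewrite mulm1.
Qed.

Lemma mmul_ucm_eq i j m m' : i != j -> mmul (ucm i) m = mmul (ucm j) m' ->
  exists m'', m = mmul (ucm j) m'' /\ m' = mmul (ucm i) m''.
Proof.
move=> ij E; pose n := divcm m (ucm j); have En : m = mmul (ucm j) n.
  apply/eqP/cmP => l; rewrite cmM divcmE cmU.
  case: eqP => [<-|_]; last by rewrite subn0.
  have := congr1 (fun m : {cmonom I} => m j) E.
  by rewrite !cmM cmUU cmU (negbTE ij) add0n => ->; rewrite add1n subn1.
exists n; split=> //; apply: (@mmul_inj (ucm j)); rewrite -E En.
by rewrite mulmA (mulmC (ucm i)) -mulmA.
Qed.

Lemma cmonom_ind (P : {cmonom I} -> Prop) :
  (forall i, P (ucm i)) ->
  (forall i m, m != mone -> P m -> P (mmul (ucm i) m)) ->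
  forall m, m != mone -> P m.
Proof.
move=> PU PM m; have [n] := ubnP (mdeg m).
elim: n m => // n IH m mn /cmonom_split[[i m'] /= E]; move: mn.
rewrite E mdegM mdegU add1n ltnS => m'n.
have [->|m'1] := eqVneq m' mone; first by rewrite mulm1.
by apply: PM => //; apply: IH.
Qed.

End Monomials.

(** * Linear forms, the ideal of k[B], and the action of R(C) *)

Section Polynomials.
Variables (k : fieldType) (C : precomm k) (I : choiceType) (b : I -> C).
Hypothesis hb : linear_basis (fun _ : I => True) b.

Notation poly := {malg k[{cmonom I}]}.
Notation J := (ideal b).
Implicit Types (p q : poly) (m : {cmonom I}) (c d : C).

Lemma bcoord_ex c : exists q : {malg k[I]}, c = lext b q.
Proof.
have [//|q [_ /eqP]] := basis_mod_gen hb (v := c).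
by rewrite subr_eq0 => /eqP; exists q.
Qed.

Lemma lext_basis_inj (q q' : {malg k[I]}) : lext b q = lext b q' -> q = q'.
Proof.
move=> E; apply/eqP; rewrite -subr_eq0; apply/eqP.
apply: (basis_mod_free hb) => //.
by rewrite (linB (lext_lin b)) E subrr.
Qed.

Definition bcoord c : {malg k[I]} := sval (cid (bcoord_ex c)).

Lemma bcoordK c : lext b (bcoord c) = c.
Proof. by rewrite /bcoord; case: cid => q /= <-. Qed.

Lemma bcoord_lin : linear bcoord.
Proof.
move=> a c d; apply: lext_basis_inj.
by rewrite (lext_lin b) !bcoordK.
Qed.

Lemma bcoord_basis i : bcoord (b i) = << i >>.
Proof. by apply: lext_basis_inj; rewrite bcoordK lextU. Qed.

Definition lf c : poly := lext (fun i => << ucm i >>) (bcoord c).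

Lemma lf_lin : linear lf.
Proof. by move=> a c d; rewrite /lf bcoord_lin lext_lin. Qed.

Lemma lf_basis i : lf (b i) = << ucm i >>.
Proof. by rewrite /lf bcoord_basis lextU. Qed.

Lemma basis_ind (V : lmodType k) (f g : C -> V) : linear f -> linear g ->
  (forall i, f (b i) = g (b i)) -> f =1 g.
Proof.
move=> f_lin g_lin fg c; rewrite -(bcoordK c) lext.unlock.
rewrite (lin_sum f_lin) (lin_sum g_lin); apply: eq_bigr => i _.
by rewrite (linZ f_lin) (linZ g_lin) fg.
Qed.

Lemma linear_formE c p : linear_form b c p -> p = lf c.
Proof.
move=> [n [x [a [-> ->]]]]; rewrite /combination (lin_sum lf_lin).
by apply: eq_bigr => i _; rewrite (linZ lf_lin) lf_basis.
Qed.

Lemma linear_form_lf c : linear_form b c (lf c).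
Proof.
have [_ _ gen] := hb; have [//|n [x [a [_ /eqP]]]] := gen c.
rewrite subr_eq0 => /eqP E; exists n, x, a; split=> //.
rewrite {1}E /combination (lin_sum lf_lin).
by apply: eq_bigr => i _; rewrite (linZ lf_lin) lf_basis.
Qed.

Definition linv m : C :=
  if head_letter m is Some (i, m') then if m' == mone then b i else 0 else 0.

Lemma linv_ucm i : linv (ucm i) = b i.
Proof.
have [|j [m [E hE]]] := @head_letterP _ (ucm i); first by rewrite cm1_eq1.
have m1 : m = mone.
  apply: mdeg_eq0I; have := congr1 (@mdeg I) E.
  by rewrite mdegM !mdegU => -[].
by rewrite /linv hE m1 eqxx; move: E; rewrite m1 mulm1 => /ucm_inj ->.
Qed.

Lemma linv0 m : (mdeg m != 1)%N -> linv m = 0.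
Proof.
move=> mdeg1; rewrite /linv; have [->|m1] := eqVneq m mone.
  by rewrite head_letter1.
have [i [m' [E ->]]] := head_letterP m1; case: eqP => // m'1.
by case/mdeg1P: mdeg1; exists i; rewrite E m'1 mulm1.
Qed.

(* The inverse of lf on linear polynomials, 0 on the other degrees. *)
Definition deg1 p : C := lext linv p.

Lemma deg1_lin : linear deg1. Proof. exact: lext_lin. Qed.

Lemma deg1U m : deg1 << m >> = linv m. Proof. exact: lextU. Qed.

Lemma deg1_lf c : deg1 (lf c) = c.
Proof.
apply: (basis_ind (f := deg1 \o lf) (g := idfun)) => // [a x y|i] /=.
  by rewrite lf_lin deg1_lin.
by rewrite lf_basis deg1U linv_ucm.
Qed.

Lemma lf_deg1 p m : (lf (deg1 p))@_m = if (mdeg m == 1)%N then p@_m else 0.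
Proof.
have [m1|m1] := boolP (mdeg m == 1)%N; last first.
  have l0 : linear (fun _ : poly => 0 : k^o) by apply: lin_zero.
  apply: (eq_linear (f := fun p => (lf (deg1 p))@_m : k^o)) l0 _.
    by move=> a u v; rewrite deg1_lin lf_lin mcoeffD mcoeffZ.
  move=> m' _; rewrite deg1U;
    have [/mdeg1P[i ->]|/linv0 ->] := boolP (mdeg m' == 1)%N.
    rewrite linv_ucm lf_basis mcoeffU; case: (ucm i =P m) m1 => [<-|//].
    by rewrite mdegU.
  by rewrite (lin0 lf_lin) mcoeff0.
apply: (@eq_linear _ _ _ (fun p => (lf (deg1 p))@_m : k^o) (fun p => p@_m :
  k^o)).
- by move=> a u v; rewrite deg1_lin lf_lin mcoeffD mcoeffZ.
- by move=> a u v; rewrite mcoeffD mcoeffZ.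
move=> m' _; rewrite deg1U; have [/mdeg1P[i ->]|m'1] := boolP (mdeg m' == 1)%N.
  by rewrite linv_ucm lf_basis.
rewrite linv0 // (lin0 lf_lin) mcoeff0 mcoeffU; case: (m' =P m) m'1 => [->|//].
by rewrite m1.
Qed.

Lemma no_const_lin a p q : no_const p -> no_const q -> no_const (a *: p + q).
Proof.
by rewrite /no_const => p0 q0; rewrite mcoeffD mcoeffZ p0 q0 mulr0 addr0.
Qed.

Lemma no_constB p q : no_const p -> no_const q -> no_const (p - q).
Proof. by rewrite /no_const => p0 q0; rewrite mcoeffB p0 q0 subrr. Qed.

Lemma no_constU m : m != mone -> no_const (<< m >> : poly).
Proof. by rewrite /no_const mcoeffU => /negbTE ->. Qed.

Lemma no_const_supp p m : no_const p -> m \in msupp p -> m != mone.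
Proof. by move=> p0; apply: contraTneq => ->; rewrite -mcoeff_eq0 p0. Qed.

Lemma no_const0 : no_const (0 : poly).
Proof. exact: mcoeff0. Qed.

Lemma no_const_mul p q : no_const p -> no_const (p * q).
Proof. by rewrite /no_const => p0; rewrite rmorphM /= p0 mul0r. Qed.

Lemma no_const_lext (K : choiceType) (h : K -> poly) (p : {malg k[K]}) :
  (forall x, no_const (h x)) -> no_const (lext h p).
Proof.
move=> h0; rewrite /no_const lext.unlock raddf_sum big1 // => x _.
by rewrite /= mcoeffZ h0 mulr0.
Qed.

Lemma no_const_lf c : no_const (lf c).
Proof. by apply: no_const_lext => i; apply: no_constU; rewrite cm1_eq1. Qed.

Lemma mulU m m' : << mmul m m' >> = << m >> * << m' >> :> poly.
Proof. by apply/malgP => n; rewrite malgM_def fgmulUU mulr1. Qed.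

Lemma mul_linr p : linear (fun q => p * q).
Proof. by move=> a q q'; rewrite mulrDr scalerAr. Qed.

Lemma mul_linl p : linear (fun q => q * p).
Proof. by move=> a q q'; rewrite mulrDl scalerAl. Qed.

Lemma deg1_mul p q : no_const p -> no_const q -> deg1 (p * q) = 0.
Proof.
move=> p0 q0; pose z (_ : poly) : C := 0.
have z_lin : linear z by apply: lin_zero.
apply: (eq_linear (f := fun p => deg1 (p * q)) (g := z)) => //.
  exact: lin_comp deg1_lin (mul_linl q).
move=> m /(no_const_supp p0) m1.
apply: (eq_linear (f := fun q => deg1 (<< m >> * q)) (g := z)) => //.
  exact: lin_comp deg1_lin (mul_linr _).
move=> m' /(no_const_supp q0) m'1; rewrite -mulU deg1U linv0 //.
rewrite mdegM; move: m1 m'1; rewrite -!mdeg_eq0.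
by case: (mdeg m) (mdeg m') => [|d] [|d'] //; rewrite addnS.
Qed.

Lemma J_lin a p q : J p -> J q -> J (a *: p + q).
Proof. by move=> Jp Jq; apply: ideal_add => //; apply: ideal_scale. Qed.

Lemma J_trans q p r : J (p - q) -> J (q - r) -> J (p - r).
Proof. by move=> pq qr; rewrite -(subrKA q); apply: ideal_add. Qed.

Lemma J_sym p q : J (p - q) -> J (q - p).
Proof. by move=> pq; rewrite -opprB -scaleN1r; apply: ideal_scale. Qed.

(** The constructor [ideal_mul] asks for a factor without constant term; the constant term acts by
    scaling. *)
Lemma J_mulr p q : J q -> J (p * q).
Proof.
move=> Jq; pose p1 := p - p@_mone *: 1.
have -> : p = p1 + p@_mone *: 1 by rewrite /p1 subrK.
rewrite mulrDl -scalerAl mul1r; apply: ideal_add; last exact: ideal_scale.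
apply: ideal_mul => //.
by rewrite /no_const /p1 mcoeffB mcoeffZ mcoeff1 eqxx mulr1 subrr.
Qed.

Lemma J_mull p q : J q -> J (q * p).
Proof. by rewrite mulrC; apply: J_mulr. Qed.

Lemma J_lext (K : choiceType) (f : {malg k[K]} -> poly) (p : {malg k[K]}) :
  linear f -> (forall m : K, m \in msupp p -> J (f << m >>)) -> J (f p).
Proof.
move=> f_lin Jf; rewrite [p]malg_sum (lin_sum f_lin) big_seq.
elim/big_rec: _ => [|m q mp Jq]; first exact: ideal_0.
by rewrite (linZ f_lin); apply: J_lin => //; apply: Jf.
Qed.

Lemma J_basis (f : C -> poly) c :
  linear f -> (forall i, J (f (b i))) -> J (f c).
Proof.
move=> f_lin Jf; rewrite -(bcoordK c).
apply: (J_lext (f := f \o lext b)) => [a x y|i _] /=.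
  by rewrite lext_lin f_lin.
by rewrite lextU.
Qed.

(** The generators are linear in their left argument. The general [c] is needed in [rb_act_J], where
    a symmetrised product of two elements takes its place. *)
Lemma J_gen c i j :
  J (lf (amul c (b i)) * << ucm j >> - lf (amul c (b j)) * << ucm i >>).
Proof.
apply: (J_basis (f := fun c => lf (amul c (b i)) * << ucm j >> -
  lf (amul c (b j)) * << ucm i >>)) => [|l].
  have lin i' j' : linear (fun c => lf (amul c (b i')) * << ucm j' >>).
    exact: lin_comp (mul_linl _) (lin_comp lf_lin (amul_linearl _)).
  exact: lin_sub.
by apply: ideal_gen; apply: linear_form_lf.
Qed.

(** Generators are quadratic and multiplication by k[B] raises degrees. Consequently C embeds into
    k[B]/I. *)
Lemma J_props p : J p -> no_const p /\ deg1 p = 0.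
Proof.
elim=> {p} [i j l p q /linear_formE -> /linear_formE ->||p q _ [p0 p1] _ [q0 q1]
  |a p _ [p0 p1]|p q p0 _ [q0 q1]].
- have xl i0 : no_const (<< ucm i0 >> : poly) by apply: no_constU;
    rewrite cm1_eq1.
  have n0 c j0 : no_const (lf c * << ucm j0 >>) by
    exact/no_const_mul/no_const_lf.
  have d0 c j0 : deg1 (lf c * << ucm j0 >>) = 0.
    exact: deg1_mul (no_const_lf c) (xl j0).
  split; first exact: no_constB (n0 _ _) (n0 _ _).
  rewrite (linB deg1_lin).
  transitivity (0 - 0 : C); last exact: subrr.
  congr (_ - _); exact: d0.
- by split; [apply: no_const0 | apply: lin0 deg1_lin].
- split; last by rewrite (linD deg1_lin) p1 q1 addr0.
  by rewrite -[p]scale1r; apply: no_const_lin p0 q0.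
- split; last by rewrite (linZ deg1_lin) p1 scaler0.
  by rewrite -[_ *: _]addr0; apply: no_const_lin p0 no_const0.
- by split; [apply: no_const_mul | apply: deg1_mul].
Qed.

(* The action of R(c) on k[B], which is well defined modulo I. *)
Definition rb_head c m : poly :=
  if head_letter m is Some (i, m') then lf (amul c (b i)) * << m' >> else 0.

Definition rb_act c p : poly := lext (rb_head c) p.

Lemma rb_act_linr c : linear (rb_act c). Proof. exact: lext_lin. Qed.

Lemma rb_actU c m : rb_act c << m >> = rb_head c m.
Proof. exact: lextU. Qed.

Lemma rb_act_linl p : linear (rb_act^~ p).
Proof.
move=> a c d; apply: (eq_linear (f := rb_act (a *: c + d))
  (g := fun p => a *: rb_act c p + rb_act d p)); first exact: rb_act_linr.
  by apply: lin_comb; apply: rb_act_linr.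
move=> m _; transitivity (a *: rb_head c m + rb_head d m).
  rewrite rb_actU /rb_head; case: head_letter => [[i m']|].
    by rewrite (amul_linearl (b i)) lf_lin mul_linl.
  by rewrite scaler0 addr0.
exact: (congr2 (fun x y => a *: x + y) (esym (rb_actU c m)) (esym (rb_actU d
  m))).
Qed.

Lemma rb_act_no_const c p : no_const (rb_act c p).
Proof.
apply: no_const_lext => m; rewrite /rb_head; case: head_letter => [[i m']|].
  exact/no_const_mul/no_const_lf.
exact: no_const0.
Qed.

Lemma rb_act1 c : rb_act c << mone >> = 0.
Proof. by rewrite rb_actU /rb_head head_letter1. Qed.

Lemma rb_act_lf c d : rb_act c (lf d) = lf (amul c d).
Proof.
apply: (basis_ind (f := fun d => rb_act c (lf d)) (g :=
  fun d => lf (amul c d))).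
- exact: lin_comp (rb_act_linr c) lf_lin.
- exact: lin_comp lf_lin (amul_linearr c).
move=> i.
have [|j [m [E hE]]] := @head_letterP _ (ucm i); first by rewrite cm1_eq1.
have m1 : m = mone.
  apply: mdeg_eq0I; have := congr1 (@mdeg I) E.
  by rewrite mdegM !mdegU => -[].
rewrite lf_basis rb_actU /rb_head hE m1.
by move: E; rewrite m1 mulm1 => /ucm_inj ->; apply: mulr1.
Qed.

Lemma rb_act_deg1 c p : deg1 (rb_act c p) = amul c (deg1 p).
Proof.
apply: (eq_linear (f := fun p => deg1 (rb_act c p)) (g :=
  fun p => amul c (deg1 p))).
- exact: lin_comp deg1_lin (rb_act_linr c).
- exact: lin_comp (amul_linearr c) deg1_lin.
move=> m _; have [/mdeg1P[i ->]|m1] := boolP (mdeg m == 1)%N.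
  by rewrite -lf_basis rb_act_lf !deg1_lf.
rewrite deg1U linv0 // (lin0 (amul_linearr _)).
have [->|mn1] := eqVneq m mone; first by rewrite rb_act1 (lin0 deg1_lin).
have [i [m' [E hE]]] := head_letterP mn1.
rewrite rb_actU /rb_head hE deg1_mul //; first exact: no_const_lf.
apply: no_constU; apply: contraNneq m1 => m'1.
by rewrite E m'1 mulm1 mdegU.
Qed.

(** This is the independence of the letter chosen by [head_letter]: R(c) may be applied to any
    linear factor. *)
Lemma rb_act_head c d p : J (rb_act c (lf d * p) - lf (amul c d) * p).
Proof.
apply: (J_lext (f := fun p => rb_act c (lf d * p) - lf (amul c d) * p)).
  apply: lin_sub (mul_linr _).
  exact: lin_comp (rb_act_linr c) (mul_linr _).
move=> m _; apply: (J_basis (f := fun d => rb_act c (lf d * << m >>) -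
  lf (amul c d) * << m >>)) => [|i].
  apply: lin_sub.
    exact: lin_comp (rb_act_linr c) (lin_comp (mul_linl _) lf_lin).
  exact: lin_comp (mul_linl _) (lin_comp lf_lin (amul_linearr c)).
rewrite lf_basis -mulU.
have [|j [m' [E hE]]] := @head_letterP _ (mmul (ucm i) m).
  by rewrite cmM_eq1 cm1_eq1.
rewrite rb_actU /rb_head hE; have [ij|ij] := eqVneq i j.
  by move: E; rewrite ij => /mmul_inj ->; rewrite subrr; apply: ideal_0.
(* Both letters divide the monomial, and the two results differ by a multiple of an element given by
   [J_gen]. *)
have [m'' [-> ->]] := mmul_ucm_eq ij E.
rewrite !mulU !mulrA -mulrBl; apply: J_mull.
exact: J_gen.
Qed.

Lemma rb_act_mul c p q : no_const p -> J (rb_act c (p * q) - rb_act c p * q).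
Proof.
move=> p0; apply: (J_lext (f := fun p => rb_act c (p * q) - rb_act c p * q)).
  apply: lin_sub (lin_comp (rb_act_linr c) (mul_linl q)) _.
  exact: lin_comp (mul_linl q) (rb_act_linr c).
move=> m /(no_const_supp p0) /cmonom_split[[i m'] /= ->].
rewrite mulU -lf_basis -mulrA; apply: J_trans (rb_act_head _ _ _) _.
rewrite mulrA -mulrBl; apply: J_mull; apply: J_sym.
exact: rb_act_head.
Qed.

(** On a generator, [rb_act_head] puts [c] in front of each product, and the precommutative identity
    turns the outcome into another instance of [J_gen]. Ideal multiples follow from [rb_act_mul],
    applied with the element of the ideal as first factor. *)
Lemma rb_act_J c p : J p -> J (rb_act c p).
Proof.
elim=> {p} [i j l p q /linear_formE -> /linear_formE ->||p q _ Jp _ Jq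
  |a p _ Jp|p q p0 Jq0 Jq].
- pose u := lf (amul c (amul (b i) (b j))) * << ucm l >> : poly.
  pose v := lf (amul c (amul (b i) (b l))) * << ucm j >> : poly.
  rewrite (linB (rb_act_linr _)) -(subrKA u); apply: ideal_add.
    exact: rb_act_head.
  rewrite -(subrKA v); apply: ideal_add; last by apply: J_sym;
    apply: rb_act_head.
  by rewrite /u /v -!pc_axiom; apply: J_gen.
- by rewrite (lin0 (rb_act_linr _)); apply: ideal_0.
- by rewrite (linD (rb_act_linr _)); apply: ideal_add.
- by rewrite (linZ (rb_act_linr _)); apply: ideal_scale.
rewrite mulrC -(subrK (rb_act c q * p) (rb_act c (q * p))).
apply: ideal_add; last exact: J_mull.
by apply: rb_act_mul; have [] := J_props Jq0.
Qed.

End Polynomials.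

HB.instance Definition _ (I : choiceType) :=
  Choice.copy (monomial I) {m : {cmonom I} | m != mone}.

(** * Normal forms modulo the ideal and the algebra they define *)

Section NormalForm.
Variables (k : fieldType) (C : precomm k) (I : choiceType) (b : I -> C).
Variable (E0 : monomial I -> Prop).
Hypothesis hb : linear_basis (fun _ : I => True) b.
Hypothesis hE0 : basis_mod (@no_const k I) (ideal b) E0
  (fun m => << val m >> : {malg k[{cmonom I}]}).

Notation poly := {malg k[{cmonom I}]}.
Notation poly0 := {malg k[monomial I]}.
Notation J := (ideal b).
Notation lf := (lf hb).
Notation rb_act := (rb_act hb).
Notation deg1 := (deg1 b).
Implicit Types (p q : poly) (u v : poly0) (c d : C).

(** After a letter is split off each monomial, both sides act on that letter alone, where this is
    the precommutative identity. *)
Lemma rb_act_comp c d p : no_const p ->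
  J (rb_act c (rb_act d p) - rb_act (amul c d + amul d c) p).
Proof.
move=> p0; apply: (J_lext (f := fun p => rb_act c (rb_act d p) -
  rb_act (amul c d + amul d c) p)).
  apply: lin_sub (lin_comp (rb_act_linr hb c) (rb_act_linr hb d)) _.
  exact: rb_act_linr.
move=> m /(no_const_supp p0) /cmonom_split[[i m'] /= ->].
rewrite mulU -(lf_basis hb).
apply: (@J_trans _ _ _ _ (rb_act c (lf (amul d (b i)) * << m' >>))).
  rewrite -(linB (rb_act_linr hb c)); apply: (rb_act_J hb).
  exact: rb_act_head.
apply: J_trans (rb_act_head hb _ _ _) _; rewrite -pc_axiom; apply: J_sym.
exact: rb_act_head.
Qed.

(** [E0] lives on nonempty monomials, while multiplication lives on all polynomials; [emb] passes
    from the first setting to the second. *)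
Definition emb u : poly := lext (fun m => << val m >>) u.

Lemma emb_lin : linear emb. Proof. exact: lext_lin. Qed.

Lemma embU m : emb << m >> = << val m >>. Proof. exact: lextU. Qed.

Lemma emb_no_const u : no_const (emb u).
Proof. by apply: no_const_lext => m; apply: no_constU; apply: (svalP m). Qed.

Lemma emb_coef u m : (emb u)@_(val m) = u@_m.
Proof.
apply: (eq_linear (f := fun u => (emb u)@_(val m) : k^o) (g := fun u => u@_m :
  k^o)).
- by move=> a x y; rewrite emb_lin mcoeffD mcoeffZ.
- by move=> a x y; rewrite mcoeffD mcoeffZ.
by move=> m' _; rewrite embU !mcoeffU (inj_eq val_inj).
Qed.

Lemma emb_inj : injective emb.
Proof. by move=> u v E; apply/malgP => m; rewrite -!emb_coef E. Qed.

Definition E0_supported u := forall m, m \in msupp u -> E0 m.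

Lemma E0_supported_lin a u v :
  E0_supported u -> E0_supported v -> E0_supported (a *: u + v).
Proof.
move=> uE vE m /(fsubsetP (msuppD_le _ _)); rewrite in_fsetU => /orP[|/vE //].
by move=> /(fsubsetP (msuppZ_le _ _)) /uE.
Qed.

Lemma E0_supported_eq u v : E0_supported u -> E0_supported v ->
  J (emb u - emb v) -> u = v.
Proof.
move=> uE vE Juv; apply/eqP; rewrite -subr_eq0; apply/eqP.
have uvE : E0_supported (u - v).
  by rewrite -scaleN1r addrC; apply: E0_supported_lin.
apply: (basis_mod_free hE0 uvE).
by rewrite -/(emb (u - v)) (linB emb_lin).
Qed.

Definition drop_const p : poly := p - p@_mone *: 1.

Lemma drop_const_lin : linear drop_const.
Proof.
apply: lin_sub => [//|a p q].
by rewrite mcoeffD mcoeffZ scalerDl scalerA.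
Qed.

Lemma drop_const_no_const p : no_const (drop_const p).
Proof.
by rewrite /no_const /drop_const mcoeffB mcoeffZ mcoeff1 eqxx mulr1 subrr.
Qed.

Lemma drop_const_id p : no_const p -> drop_const p = p.
Proof. by rewrite /drop_const => ->; rewrite scale0r subr0. Qed.

Lemma nf_ex p : exists u, E0_supported u /\ J (drop_const p - emb u).
Proof.
have [u [uE uJ]] := basis_mod_gen hE0 (drop_const_no_const p).
by exists u.
Qed.

(* The normal form modulo I, the constant term being discarded. *)
Definition nf p : poly0 := sval (cid (nf_ex p)).

Lemma nf_E0 p : E0_supported (nf p).
Proof. by rewrite /nf; case: cid => u []. Qed.

Lemma nf_J p : no_const p -> J (p - emb (nf p)).
Proof.
move=> /drop_const_id p0; rewrite -{1}p0 /nf.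
by case: cid => u [].
Qed.

Lemma nf_drop p : J (drop_const p - emb (nf p)).
Proof. by rewrite /nf; case: cid => u []. Qed.

Lemma nf_lin : linear nf.
Proof.
move=> a p q; apply: E0_supported_eq.
- exact: nf_E0.
- by apply: E0_supported_lin; apply: nf_E0.
apply: J_trans (J_sym (nf_drop _)) _;
  rewrite drop_const_lin emb_lin opprD addrACA.
by rewrite -scalerBr; apply: J_lin; apply: nf_drop.
Qed.

Lemma nf_eq p q : J (p - q) -> nf p = nf q.
Proof.
move=> Jpq; have [/drop_const_id pq0 _] := J_props hb Jpq.
apply: E0_supported_eq; try exact: nf_E0.
apply: J_trans (J_sym (nf_drop _)) _; apply: J_trans (nf_drop q).
by rewrite -(linB drop_const_lin) pq0.
Qed.

Lemma nf_emb u : E0_supported u -> nf (emb u) = u.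
Proof.
move=> uE; apply: E0_supported_eq uE _; first exact: nf_E0.
exact: J_sym (nf_J (emb_no_const u)).
Qed.

Lemma deg1_nf p : deg1 (emb (nf p)) = deg1 p.
Proof.
have d1 : deg1 (drop_const p) = deg1 p.
  rewrite /drop_const (linB (deg1_lin b)) (linZ (deg1_lin b)).
  by rewrite deg1U linv0 ?mdeg1 // scaler0 subr0.
have [_ /eqP] := J_props hb (nf_drop p).
by rewrite (linB (deg1_lin b)) subr_eq0 d1 => /eqP.
Qed.

(** Reduction modulo the ideal keeps the linear part, so a letter occurs with coefficient 1 in its
    own normal form. *)
Lemma E0_ucm i (m : monomial I) : val m = ucm i -> E0 m.
Proof.
move=> mi; apply: (@nf_E0 << ucm i >>); rewrite -mcoeff_neq0 -emb_coef mi.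
have := lf_deg1 hb (emb (nf << ucm i >>)) (ucm i).
rewrite mdegU deg1_nf deg1U linv_ucm lf_basis mcoeffUU eqxx => <-.
exact: oner_neq0.
Qed.

Definition ucm0 i : monomial I := exist _ (ucm i) (negbT (cm1_eq1 i)).

Lemma nf_lf c : emb (nf (lf c)) = lf c.
Proof.
move: c; apply: (basis_ind hb) => [||i].
- exact: lin_comp emb_lin (lin_comp nf_lin (lf_lin hb)).
- exact: lf_lin.
rewrite lf_basis -(embU (ucm0 i)) nf_emb // => m.
by rewrite msuppU oner_eq0 in_fset1 => /eqP ->; apply: (E0_ucm (i := i)).
Qed.

(** The carrier is all of k[B], neither a quotient nor the span of [E0]. Products and actions end
    with [nf], so the required laws hold although elements need not be in normal form. *)
Definition amodel_mul u v : poly0 := nf (emb u * emb v).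

Lemma amodel_mul_linearl v : linear (amodel_mul^~ v).
Proof. exact: lin_comp nf_lin (lin_comp (mul_linl _) emb_lin). Qed.

Lemma amodel_mul_linearr u : linear (amodel_mul u).
Proof. exact: lin_comp nf_lin (lin_comp (mul_linr _) emb_lin). Qed.

Definition amodel : algebra k :=
  Algebra amodel_mul_linearl amodel_mul_linearr.

Lemma amodel_mulC : commutative (@amul k amodel).
Proof. by move=> u v; rewrite /= /amodel_mul mulrC. Qed.

Lemma nf_mul p q : no_const p -> nf (emb (nf p) * q) = nf (p * q).
Proof.
move=> p0; apply: nf_eq; rewrite -mulrBl; apply: (J_mull).
exact: J_sym (nf_J p0).
Qed.

Lemma emb_mul_no_const u v : no_const (emb u * emb v).
Proof. exact/no_const_mul/emb_no_const. Qed.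

Lemma amodel_mulA : associative (@amul k amodel).
Proof.
move=> u v w; transitivity (nf (emb u * emb v * emb w)); last first.
  exact/esym/nf_mul/emb_mul_no_const.
rewrite amodel_mulC; apply: etrans (nf_mul _ (emb_mul_no_const _ _)) _.
have rot p q r : p * q * r = r * p * q.
  exact: etrans (mulrC _ _) (mulrA _ _ _).
exact: congr1 (rot _ _ _).
Qed.

Definition amodel_act c u : poly0 := nf (rb_act c (emb u)).

Lemma amodel_act_linl u : linear (amodel_act^~ u).
Proof. exact: lin_comp nf_lin (rb_act_linl hb (emb u)). Qed.

Lemma amodel_act_linr c : linear (amodel_act c).
Proof. exact: lin_comp nf_lin (lin_comp (rb_act_linr hb c) emb_lin). Qed.

Lemma nf_act c p : no_const p -> nf (rb_act c (emb (nf p))) = nf (rb_act c p).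
Proof.
move=> p0; apply: nf_eq; rewrite -(linB (rb_act_linr hb c)).
exact: (rb_act_J hb c (J_sym (nf_J p0))).
Qed.

Lemma amodel_actA c d u :
  amodel_act c (amodel_act d u) = amodel_act (amul c d + amul d c) u.
Proof.
apply: etrans (nf_act _ (rb_act_no_const hb _ _)) _; apply: nf_eq.
exact: rb_act_comp (emb_no_const u).
Qed.

Lemma amodel_act_mul c u v :
  amodel_act c (amodel_mul u v) = amodel_mul (amodel_act c u) v.
Proof.
apply: etrans (nf_act _ (emb_mul_no_const _ _)) _.
apply: etrans (esym (nf_mul _ (rb_act_no_const hb _ _))).
apply: nf_eq; exact: rb_act_mul (emb_no_const u).
Qed.

End NormalForm.

(** * Evaluation of monomials and words *)

Section MonomialEvaluation.
Variables (k : fieldType) (V : comRBalg k) (I : choiceType).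

Notation oop := (oAC (@rb_mulA k V) (@rb_mulC k V)).

(** Without a unit, iterated products are computed in the option type, where [None] is neutral;
    reordering factors is then a fact about big operators. *)
Lemma foldl_amul_big (x : V) s :
  Some (foldl (@amul k V) x s) = \big[oop/None]_(y <- x :: s) Some y.
Proof.
elim: s x => [|y s IH] x /=; first by rewrite big_seq1.
by rewrite IH !big_cons Monoid.mulmA.
Qed.

Lemma letters_nil (m : {cmonom I}) : letters m = [::] -> m = mone.
Proof.
by move=> l0; apply/eqP/cmP => i; rewrite -count_letters l0 cm1.
Qed.

Lemma mon_eval_big (g : I -> V) m : m != mone ->
  Some (mon_eval g m) = \big[oop/None]_(i <- letters m) Some (g i).
Proof.
move=> m1; rewrite -(big_map g xpredT (fun y => Some y)) /mon_eval.
case E: [seq _ | _ <- _] => [|x s]; last exact: foldl_amul_big.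
by case: (letters m) (@letters_nil m) E m1 => // -> //; rewrite eqxx.
Qed.

Lemma mon_evalM (g : I -> V) m m' : m != mone -> m' != mone ->
  mon_eval g (mmul m m') = amul (mon_eval g m) (mon_eval g m').
Proof.
move=> m1 m1'; apply: Some_inj; rewrite mon_eval_big; last first.
  by rewrite cmM_eq1 (negbTE m1).
rewrite -[RHS]/(oop (Some _) (Some _)) !mon_eval_big // -big_cat.
apply: perm_big; apply/allP => i _ /=.
by rewrite count_cat !count_letters cmM.
Qed.

End MonomialEvaluation.

Lemma mon_eval_hom (k : fieldType) (U V : comRBalg k) (I : choiceType)
    (f : U -> V) (g : I -> U) m : rb_hom f ->
  f (mon_eval g m) = mon_eval (f \o g) m.
Proof.
move=> [[f_lin fM] _]; rewrite /mon_eval (map_comp f g).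
case: [seq g i | i <- letters m] => [|x s] /=; first exact: (lin0 f_lin).
by elim: s x => //= y s IH x; rewrite IH fM.
Qed.

Lemma word_eval_hom (k : fieldType) (U V : comRBalg k) (I : choiceType)
    (f : U -> V) (g : I -> U) u : rb_hom f ->
  f (word_eval g u) = word_eval (f \o g) u.
Proof.
move=> hf; have [[_ fM] fR] := hf.
elim: u => [m|u IH|u IH m] /=; first exact: mon_eval_hom.
  by rewrite fR IH.
by rewrite fM fR IH mon_eval_hom.
Qed.

(** * Series concentrated at the empty word *)

Section ConstantSeries.
Variables (k : fieldType) (G : choiceType).

Definition const_fun (V : lmodType k) (u : V) (w : seq G) : V :=
  if w is [::] then u else 0.

Lemma const_finite (V : lmodType k) (u : V) n : exists L : {fset G}, forall w,
  (size w <= n)%N -> ~~ all (mem L) w -> const_fun u w = 0.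
Proof. by exists fset0 => -[]. Qed.

Definition const_series (V : lmodType k) (u : V) :
  series G V := mkseries (const_finite u).

Lemma const_series_lin (V : lmodType k) : linear (@const_series V).
Proof.
by move=> a u v; apply: seriesP => -[|x w]; rewrite coef_lin //= scaler0 addr0.
Qed.

Lemma smap_finite (V W : lmodType k) (h : V -> W) (h_lin : linear h)
    (f : series G V) n : exists L : {fset G}, forall w,
  (size w <= n)%N -> ~~ all (mem L) w -> h (f w) = 0.
Proof.
have [L fL] := coef_letters f n; exists L => w wn wL.
by rewrite fL // (lin0 h_lin).
Qed.

Definition smap (V W : lmodType k) (h : V -> W) (h_lin : linear h)
  (f : series G V) : series G W := mkseries (smap_finite h_lin f).

Lemma smap_lin (V W : lmodType k) (h : V -> W) (h_lin : linear h) :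
  linear (smap h_lin).
Proof. by move=> a f g; apply: seriesP => w; apply: h_lin. Qed.

Variable D : shuffle_datum k G.
Implicit Types (f : series G D) (u v : D).

Lemma smul_const f u w : smul f (const_series u) w = amul (f w) u.
Proof. exact: shuffle_const. Qed.

Lemma smul_const2 u v : smul (const_series u) (const_series v) =
  const_series (amul u v) :> series G D.
Proof.
apply: seriesP => w; rewrite smul_const; case: w => [|x w] //=.
exact: lin0 (amul_linearl v).
Qed.

Lemma sdiff_series_lin : linear (@sdiff_series k G D).
Proof. by move=> a f g; apply: seriesP => w; apply: sdiff_lin. Qed.

Lemma sdiff_seriesK f : sdiff_series (srb f) = f.
Proof. by apply: seriesP => w; apply: sdiffK. Qed.

Lemma sdiff_const_one a : sdiff_series (const_series (a *: sd_one D)) =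
  0 :> series G D.
Proof.
apply: seriesP => w; rewrite -[LHS]/(sdiff _ w) /sdiff.
rewrite (_ : fsum _ = 0) ?addr0; last first.
  rewrite -[RHS](fsum0 G D); congr fsum; apply/funext => x.
  exact: lin0 (amul_linearl _).
case: w => [|x w]; last exact: lin0 (@sd_del_lin _ _ D).
by rewrite (linZ (@sd_del_lin _ _ D)) sd_del_one scaler0.
Qed.

(** Only the correction term of [sint] survives, and it is scalar by construction. This is applied
    to the series of E-words x with R(x) good. *)
Lemma srb_scalar f : (forall w, sd_sig (f w) = 0) ->
  forall w, exists a : k, srb f w = a *: sd_one D.
Proof.
move=> f0 [|x w]; rewrite srbE /sint f0.
  by exists 0; rewrite addr0 scale0r.
by exists (sd_co x (sprim f w)); rewrite add0r.
Qed.

Lemma srb_nil f : srb f [::] = sd_sig (f [::]).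
Proof. exact: addr0. Qed.

(** The hypothesis puts [u] in the image of the derivation, so its primitive needs no letter. *)
Lemma srb_const u : (forall x, sd_co x u = 0) ->
  srb (const_series u) = const_series (sd_sig u).
Proof.
move=> u0; apply: seriesP => -[|x w]; rewrite srbE /sint; first exact: addr0.
rewrite (lin0 (@sd_sig_lin _ _ D)) add0r /sprim.
rewrite (_ : fsum _ = 0) ?subr0; last first.
  rewrite -[RHS](fsum0 G D); congr fsum; apply/funext => y /=.
  by rewrite (lin0 (@sd_sig_lin _ _ D)) (lin0 (amul_linearl _)).
case: w => [|y w] /=; first by rewrite u0 scale0r.
by rewrite (lin0 (@sd_co_lin _ _ D _)) scale0r.
Qed.

End ConstantSeries.

(** * The model: a commutative Rota-Baxter algebra containing C *)

Section Model.
Variables (k : fieldType) (C : precomm k) (I : choiceType) (b : I -> C).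
Hypothesis hb : linear_basis (fun _ : I => True) b.

(* A stands for k[B]/I, act c for the action of R(c) on it, and el embeds C as
   the linear part of A, with retraction dg; the elements xi x form a basis of
   the kernel of dg, with coordinates xco x. *)
Variables (A : algebra k) (act : C -> A -> A) (el : C -> A) (dg : A -> C).
Variables (X : choiceType) (xi : X -> A) (xco : X -> A -> k^o).
Hypothesis A_mulC : commutative (@amul k A).
Hypothesis A_mulA : associative (@amul k A).
Hypothesis act_linl : forall a, linear (act^~ a).
Hypothesis act_linr : forall c, linear (act c).
Hypothesis actA : forall c d a,
  act c (act d a) = act (amul c d + amul d c) a.
Hypothesis act_mul : forall c a a', act c (amul a a') = amul (act c a) a'.
Hypothesis el_lin : linear el.
Hypothesis dg_lin : linear dg.
Hypothesis dg_el : cancel el dg.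
Hypothesis act_el : forall c d, act c (el d) = el (amul c d).
Hypothesis dg_act : forall c a, dg (act c a) = amul c (dg a).
Hypothesis dg_xi : forall x, dg (xi x) = 0.
Hypothesis xco_lin : forall x, linear (xco x).
Hypothesis xco_xi : forall x y, xco x (xi y) = (y == x)%:R.
Hypothesis xco_el : forall x c, xco x (el c) = 0.
Hypothesis xco_fin : forall a, finsup (xco^~ a).
Hypothesis xco_sep : forall a, (forall x, xco x a = 0) -> a = el (dg a).

Definition scalar_mul (x y : k^o) : k^o := x * y.

Lemma scalar_mul_linearl y : linear (scalar_mul^~ y).
Proof. by move=> a x x'; rewrite /scalar_mul mulrDl -scalerAl. Qed.

Lemma scalar_mul_linearr x : linear (scalar_mul x).
Proof. by move=> a y y'; rewrite /scalar_mul mulrDr -scalerAr. Qed.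

Definition scalar_alg : algebra k :=
  Algebra scalar_mul_linearl scalar_mul_linearr.

Definition sym_mul (c d : C) : C := amul c d + amul d c.

Lemma sym_mulC : commutative sym_mul.
Proof. by move=> c d; apply: addrC. Qed.

Lemma sym_mul_linearl d : linear (sym_mul^~ d).
Proof.
move=> a c c'; rewrite /sym_mul (amul_linearl d) (amul_linearr d).
by rewrite scalerDr addrACA.
Qed.

Lemma sym_mul_linearr c : linear (sym_mul c).
Proof. by move=> a d d'; rewrite 3!(sym_mulC c) sym_mul_linearl. Qed.

(** Left multiplications in a precommutative algebra commute ([swap]), and this matches the two
    expansions given by [key]. *)
Lemma sym_mulA : associative sym_mul.
Proof.
have key (c d e : C) : sym_mul c (sym_mul d e) =
    amul c (amul d e) + amul c (amul e d) + amul d (amul e c).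
  by rewrite {1}/sym_mul /sym_mul pc_axiom (linD (amul_linearr c)).
have swap (c d e : C) : amul c (amul d e) = amul d (amul c e).
  by rewrite -!pc_axiom addrC.
move=> c d e; rewrite (sym_mulC (sym_mul c d)) !key (swap c e d) (swap d e c).
by rewrite -addrA addrC.
Qed.

Definition sym_alg : algebra k := Algebra sym_mul_linearl sym_mul_linearr.

Lemma scale_linl (c : C) : linear (fun x : k^o => x *: c).
Proof. by move=> a x y; rewrite scalerDl scalerA. Qed.

Lemma scale_linr (x : k^o) : linear (fun c : C => x *: c).
Proof. by move=> a c d; rewrite scalerDr !scalerA mulrC. Qed.

Definition Hmodel : algebra k := @semidirect k scalar_alg sym_alg
  (fun x c => x *: c) (@mulrC k) sym_mulC scale_linl scale_linr.

Lemma Hmodel_mulC : commutative (@amul k Hmodel).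
Proof. by apply: sdmulC; [apply: mulrC | apply: sym_mulC]. Qed.

Lemma Hmodel_mulA : associative (@amul k Hmodel).
Proof.
apply: sdmulA.
- exact: (@mulrC k).
- exact: (@mulrA k).
- exact: sym_mulC.
- exact: sym_mulA.
- exact: scale_linr.
- by move=> x y c; rewrite scalerA.
- by move=> x c d; rewrite /= (linZ (sym_mul_linearl d)).
Qed.

Definition Hact (h : Hmodel) (u : A) : A := h.1 *: u + act h.2 u.

Lemma Hact_linl u : linear (Hact^~ u).
Proof.
move=> a g h; rewrite /Hact /= (act_linl u) scalerDr addrACA.
by rewrite scalerDl scalerA.
Qed.

Lemma Hact_linr h : linear (Hact h).
Proof. by apply: lin_comb. Qed.

Lemma HactA g h u : Hact g (Hact h u) = Hact (amul g h) u.
Proof.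
case: g h => [x c] [y d]; rewrite /Hact /= (linD (act_linr c)).
rewrite (linZ (act_linr c)) actA scalerDr scalerA.
rewrite [in RHS](linD (act_linl u)) [in RHS](linD (act_linl u)).
by rewrite !(linZ (act_linl u)) !addrA.
Qed.

Lemma Hact_mul h u v : Hact h (amul u v) = amul (Hact h u) v.
Proof.
by rewrite /Hact (linD (amul_linearl v)) (linZ (amul_linearl v)) act_mul.
Qed.

Definition Umodel : algebra k := @semidirect k Hmodel A Hact
  Hmodel_mulC A_mulC Hact_linl Hact_linr.

Lemma Umodel_mulC : commutative (@amul k Umodel).
Proof. exact: sdmulC Hmodel_mulC A_mulC. Qed.

Lemma Umodel_mulA : associative (@amul k Umodel).
Proof.
exact: sdmulA Hmodel_mulC Hmodel_mulA A_mulC A_mulA Hact_linr HactA Hact_mul.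
Qed.

Implicit Types (u v : Umodel).

Definition uone : Umodel := ((1, 0), 0).
Definition ueps u : k^o := u.1.1.
Definition udel u : Umodel := ((0, 0), el u.1.2).
Definition usig u : Umodel := ((0, dg u.2), 0).
Definition uH u : Prop := u.2 = 0.

(** C occurs twice in [Umodel]: inside H, where it stands for R(C), and as the linear part of A,
    which is the image of [udel]. The first copy belongs to the complement, so the unit ([None]) and
    the basis of C are letters beside the nonlinear [xi]. *)
Definition letter : Type := option (I + X).
HB.instance Definition _ := Choice.on letter.

Definition uletter (x : letter) : Umodel :=
  match x with
  | None => uone
  | Some (inl i) => ((0, b i), 0)
  | Some (inr m) => ((0, 0), xi m)
  end.

Definition ucoord (x : letter) u : k^o :=
  match x with
  | None => u.1.1
  | Some (inl i) => (bcoord hb u.1.2)@_i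
  | Some (inr m) => xco m u.2
  end.

Lemma uone_mul : left_id uone (@amul k Umodel).
Proof.
move=> [[x c] a]; rewrite /= /sdmul /= /Hact /= /sdmul /= /scalar_mul mul1r.
rewrite scale1r scaler0 addr0 (lin0 (sym_mul_linearl _)) addr0.
rewrite scale1r (lin0 (act_linl _)) addr0 scaler0 (lin0 (act_linr _)).
by rewrite !addr0 (lin0 (amul_linearl _)) addr0.
Qed.

Lemma uH_mul u v : uH u -> uH v -> uH (amul u v).
Proof.
rewrite /uH /= => -> ->; rewrite !(lin0 (Hact_linr _)) !add0r.
exact: lin0 (amul_linearl _).
Qed.

Lemma udel_lin : linear udel.
Proof.
move=> a u v; congr (_, _); last exact: el_lin.
by congr (_, _); rewrite /= scaler0 addr0.
Qed.

Lemma usig_lin : linear usig.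
Proof.
move=> a u v; congr (_, _); last by rewrite /= scaler0 addr0.
by congr (_, _); [rewrite /= scaler0 addr0 | apply: dg_lin].
Qed.

(** On C this says that the symmetrised product of [c] and [d] is the action of [c] on [el d] plus
    that of [d] on [el c], which is [act_el]. *)
Lemma udel_mul u v : uH u -> uH v ->
  udel (amul u v) = amul (udel u) v + amul u (udel v).
Proof.
case: u v => [[x c] a] [[y d] a']; rewrite /uH /= => -> ->.
have z0 (h : Hmodel) : Hact h 0 = 0 by apply: lin0 (Hact_linr h).
have m0 (u : A) : amul u 0 = 0 by apply: lin0 (amul_linearr u).
have m1 (u : A) : amul 0 u = 0 by apply: lin0 (amul_linearl u).
have h0 (h : Hmodel) : amul (0 : Hmodel) h = 0 by apply: lin0 (amul_linearl h).
have h1 (h : Hmodel) : amul h (0 : Hmodel) = 0 by apply: lin0 (amul_linearr h).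
congr (_, _).
  rewrite -[LHS]/(0 : Hmodel) -[RHS]/(amul (0 : Hmodel) ((y, d) : Hmodel) +
    amul ((x, c) : Hmodel) (0 : Hmodel)).
  by rewrite h0 h1 addr0.
rewrite /= /sdmul /= z0 m0 m1 !addr0 !add0r /Hact /= !act_el.
rewrite -!(linZ el_lin) -!(linD el_lin); congr el.
rewrite /sym_mul.
by rewrite [RHS](AC (2*2) (3*1*(4*2))).
Qed.

Lemma usig_del u : uH u -> usig (udel u) = u - ueps u *: uone.
Proof.
case: u => [[x c] a]; rewrite /uH /= => ->.
congr (_, _); last by rewrite /= scaler0 subr0.
congr (_, _); last by rewrite /= scaler0 subr0 dg_el.
by rewrite /= [_ *: _]mulr1 subrr.
Qed.

(** H times a letter of H stays in H, and the action of C on A preserves the kernel of [dg]. *)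
Lemma usig_letter u x : uH u -> usig (amul u (uletter x)) = 0.
Proof.
rewrite /uH => u0; have z0 (h : Hmodel) : Hact h 0 =
  0 by apply: lin0 (Hact_linr h).
have m1 (a : A) : amul 0 a = 0 by apply: lin0 (amul_linearl a).
congr ((_, _), _); rewrite /= /sdmul /= u0 z0 m1 !addr0.
case: x => [[i|m]|] /=; rewrite ?z0 ?(lin0 dg_lin) //.
rewrite (linD dg_lin) (linZ dg_lin) dg_act dg_xi scaler0 add0r.
exact: lin0 (amul_linearr _).
Qed.

Lemma ucoord_lin x : linear (ucoord x).
Proof.
case: x => [[i|m]|] a u v //=; last exact: xco_lin.
by rewrite bcoord_lin mcoeffD mcoeffZ.
Qed.

Lemma ucoord_letter x y : ucoord x (uletter y) = (y == x)%:R.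
Proof.
have c0 i : (bcoord hb 0)@_i = 0 by rewrite (lin0 (bcoord_lin hb)) mcoeff0.
case: x y => [[i|m]|] [[j|n]|] //=; rewrite ?c0 ?(lin0 (xco_lin _)) //.
by rewrite bcoord_basis mcoeffU mulrb.
Qed.

Lemma ucoord_fin u : finsup (ucoord^~ u).
Proof.
have [L uL] := xco_fin u.2.
exists (None |` ((fun i => Some (inl i)) @` msupp (bcoord hb u.1.2) `|`
  (fun m => Some (inr m)) @` L))%fset => x.
rewrite in_fset1U in_fsetU !negb_or => /and3P[x0 xl xr].
case: x x0 xl xr => [[i|m]|] //= _ xl xr.
  apply: mcoeff_outdom; apply: contra xl => il; apply/imfsetP.
  by exists i.
by apply: uL; apply: contra xr => mL; apply/imfsetP; exists m.
Qed.

Lemma ucoord_sep u : dg u.2 = 0 -> (forall x, ucoord x u = 0) -> u = 0.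
Proof.
case: u => [[x c] a] /= a0 ux; congr ((_, _), _).
- exact: ux None.
- rewrite -(bcoordK hb c) -[RHS](lin0 (lext_lin b)); congr (lext b _).
  by apply/malgP => i; rewrite mcoeff0 -(ux (Some (inl i))).
- rewrite (xco_sep (a := a)) ?a0 ?(lin0 el_lin) // => m.
  exact: ux (Some (inr m)).
Qed.

Lemma ucoord_fsum (f : letter -> k^o) y : finsup f ->
  ucoord y (fsum (fun x => f x *: uletter x)) = f y.
Proof.
move=> [L fL]; rewrite -(fsum_map (ucoord_lin y)); last first.
  by exists L => x /fL ->; rewrite scale0r.
rewrite (fsum1 (y := y)) => [|x xy]; last first.
  rewrite (linZ (ucoord_lin y)) ucoord_letter (negbTE xy); exact: mulr0.
rewrite (linZ (ucoord_lin y)) ucoord_letter eqxx; exact: mulr1.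
Qed.

Lemma uletter_free (f : letter -> k^o) : finsup f ->
  fsum (fun x => f x *: uletter x) = 0 -> forall x, f x = 0.
Proof.
move=> ff f0 x; rewrite -(ucoord_fsum x ff) f0; exact: lin0 (ucoord_lin x).
Qed.

(** Both sides have the same coordinates and are killed by [dg]; by [ucoord_sep] these data
    determine an element. *)
Lemma ucoord_sum u :
  fsum (fun x => ucoord x u *: uletter x) = u - udel (usig u).
Proof.
apply/eqP; rewrite -subr_eq0; apply/eqP; apply: ucoord_sep.
  have dg2_lin : linear (fun v : Umodel => dg v.2) by move=> a v w;
    apply: dg_lin.
  rewrite (linB dg2_lin) (linB dg2_lin) /= dg_el subrr subr0.
  rewrite -(fsum_map dg2_lin); last first.
    by have [L uL] := ucoord_fin u; exists L => x /uL ->; rewrite scale0r.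
  rewrite -[RHS](fsum0 letter C); congr fsum; apply/funext => x.
  rewrite (linZ dg2_lin); case: x => [[i|m]|] /=.
  - by rewrite (lin0 dg_lin) scaler0.
  - by rewrite dg_xi scaler0.
  - by rewrite (lin0 dg_lin) scaler0.
move=> x; rewrite (linB (ucoord_lin x)) (linB (ucoord_lin x)).
rewrite (ucoord_fsum x (ucoord_fin u)).
rewrite (_ : ucoord x (udel (usig u)) = 0) ?subr0 ?subrr //.
by case: x => [[i|m]|] //=; rewrite (lin0 (bcoord_lin hb)) mcoeff0.
Qed.

Lemma uH_lin a u v : uH u -> uH v -> uH (a *: u + v).
Proof. by rewrite /uH /= => -> ->; rewrite scaler0 addr0. Qed.

Lemma udel_one : udel uone = 0.
Proof. by rewrite /udel /= (lin0 el_lin). Qed.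

Lemma ueps_lin : linear ueps. Proof. by []. Qed.

Lemma ueps_sigM u v : ueps (amul (usig u) (usig v)) = 0.
Proof. exact: mul0r. Qed.

Definition model_datum : shuffle_datum k letter :=
  @ShuffleDatum k letter Umodel Umodel_mulC Umodel_mulA uone uone_mul
  uH uH_lin uH_mul erefl ueps ueps_lin udel udel_lin udel_one udel_mul
  usig usig_lin (fun _ => erefl) usig_del (fun _ => erefl) ueps_sigM
  uletter uletter_free usig_letter ucoord ucoord_lin ucoord_fin ucoord_sum.

Notation D := model_datum.

Definition umodel_RB : comRBalg k := series_RB D.

Notation N := umodel_RB.

Definition uA (a : A) : D := ((0, 0), a).

Lemma uA_lin : linear uA.
Proof.
move=> x a a'; congr (_, _).
by congr (_, _); rewrite /= scaler0 addr0.
Qed.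

Lemma umul_uA (u : D) a : uH u -> amul u (uA a) = uA (Hact u.1 a).
Proof.
move=> u0; congr (_, _); first exact: (lin0 (amul_linearr (u.1 : Hmodel))).
rewrite /= /sdmul /= u0 (lin0 (amul_linearl _)) addr0.
by rewrite (lin0 (Hact_linr _)) addr0.
Qed.

Lemma uA_mul a a' : amul (uA a) (uA a') = uA (amul a a').
Proof.
have z (u : A) : Hact ((0, 0) : Hmodel) u = 0 by apply: (lin0 (Hact_linl u)).
congr (_, _); first exact: (lin0 (amul_linearl (0 : Hmodel))).
by rewrite /= /sdmul /= z z add0r add0r.
Qed.

Definition upsi (c : C) : N := @const_series k letter D (uA (el c) : D).

(** R sends the constant series [el c] to the constant [c] of H, which then acts on [el d] by
    [act_el]. *)
Lemma upsi_hom : @alg_hom k C (derived N) upsi.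
Proof.
split=> [a c d|c d].
  rewrite /upsi -[RHS](@const_series_lin k letter D) el_lin uA_lin.
  by [].
apply/esym; rewrite [LHS]/(smul (srb (upsi c)) (upsi d)) /upsi srb_const.
  apply: etrans (smul_const2 _ _) _; congr const_series.
  apply: etrans (umul_uA _ _) _ => //.
  by rewrite /= dg_el /Hact scale0r add0r act_el.
by move=> [[i|m]|] //=; rewrite (lin0 (bcoord_lin hb)) mcoeff0.
Qed.

Variables (vec : {cmonom I} -> A) (phi : monomial I -> A -> k^o).
Variable (E0 : monomial I -> Prop).
Hypothesis vec_ucm : forall i, vec (ucm i) = el (b i).
Hypothesis vec_mul : forall i m, m != mone ->
  vec (mmul (ucm i) m) = amul (el (b i)) (vec m).
Hypothesis dg_vec : forall m, mdeg m != 1%N -> dg (vec m) = 0.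
Hypothesis phi_lin : forall m, linear (phi m).
Hypothesis phi_vec : forall m m', E0 m' -> phi m (vec (val m')) = (m' == m)%:R.

Notation ev := (word_eval (upsi \o b)).
Notation cA a := (@const_series k letter D (uA a : D) : N).

Lemma ev_monomial m : m != mone -> mon_eval (upsi \o b) m = cA (vec m).
Proof.
move: m; apply: cmonom_ind => [i|i m m1 IH].
  by rewrite mon_eval_var /= /upsi vec_ucm.
rewrite mon_evalM ?cm1_eq1 // IH mon_eval_var vec_mul //.
by rewrite -uA_mul; apply: smul_const2.
Qed.

Lemma ev_WRMon x (m : monomial I) w :
  (ev (WRMon x m) : N) w = amul (srb (ev x : N) w) (uA (vec (val m))).
Proof.
rewrite [LHS]/(smul (srb (ev x : N)) (mon_eval (upsi \o b) (val m) : N) w).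
by rewrite ev_monomial ?(svalP m) //; apply: smul_const.
Qed.

Lemma srb_H (f : N) w : (srb f w).2 = 0.
Proof. exact: (@sint_H k letter D f w). Qed.

(** Nonlinear monomials have no linear part and values of R lie in H. For R(x)w the induction
    hypothesis makes R(x) scalar-valued, so all values are multiples of the nonlinear w. *)
Lemma ev_good x : Eword E0 x -> good x -> forall w, usig ((ev x : N) w) = 0.
Proof.
have usig0 (u : D) : dg u.2 = 0 -> usig u = 0 by rewrite /usig => ->.
elim=> {x} [m _ gm|x _ _ _|x m _ IH gx _ gm] w; apply: usig0.
- rewrite [ev _]ev_monomial ?(svalP m) //; case: w => [|y w].
    by apply: dg_vec; apply/mdeg1P => -[i /gm].
  exact: (lin0 dg_lin).
- by rewrite [X in dg X]srb_H (lin0 dg_lin).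
rewrite ev_WRMon.
have [a ->] := @srb_scalar _ _ D (ev x : N) (IH gx) w.
rewrite (linZ (amul_linearl _)) (@sd_mul1 _ _ D) [LHS](linZ dg_lin) dg_vec
  ?scaler0 //.
by apply/mdeg1P => -[i /gm].
Qed.

Lemma ev_WRMon_scalar x m : Eword E0 x -> good x -> forall w, exists a : k,
  (srb (ev x : N) : N) w = a *: sd_one D /\
  (ev (WRMon x m) : N) w = uA (a *: vec (val m)).
Proof.
move=> xE gx w; have [a xa] := @srb_scalar _ _ D (ev x : N) (ev_good xE gx) w.
exists a; split=> //; rewrite ev_WRMon xa (linZ (amul_linearl _)).
by rewrite (@sd_mul1 _ _ D) (linZ uA_lin).
Qed.

Definition uhead (u : D) : D := (u.1, 0).

Lemma uhead_lin : linear uhead.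
Proof. by move=> a u v; congr (_, _); rewrite /= scaler0 addr0. Qed.

(** The coefficient is returned as a multiple of the unit, so that on R(y)m it restores the
    scalar-valued series R(y), to which the derivation applies. *)
Definition ucoef (m : monomial I) (u : D) : D := phi m u.2 *: sd_one D.

Lemma ucoef_lin m : linear (ucoef m).
Proof. by move=> a u v; rewrite /ucoef phi_lin scalerDl scalerA. Qed.

(* The coordinate of a series along the E-word u: it undoes the construction
   of u, the operator R being inverted by the derivation. *)
Fixpoint ecoord (u : word I) (f : N) : k^o :=
  match u with
  | WMon m => phi m (f [::]).2
  | WR x => ecoord x (sdiff_series (smap uhead_lin f))
  | WRMon x m => ecoord x (sdiff_series (smap (ucoef_lin m) f))
  end.

Lemma ecoord_lin (u : word I) : linear (ecoord u).
Proof.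
elim: u => [m|x IH|x IH m] a f g /=; first exact: phi_lin.
  by rewrite smap_lin sdiff_series_lin IH.
by rewrite smap_lin sdiff_series_lin IH.
Qed.

(** Words of type 2 have values in H, the others in A; this separates type 2. Types 1 and 3 are told
    apart by the value at the empty word in one direction and by the derivation in the other. *)
Lemma ecoord_eq (u v : word I) : Eword E0 u -> Eword E0 v ->
  ecoord u (ev v) = if pselect (u = v) then 1 else 0.
Proof.
have l0 x : ecoord x 0 = 0 by apply: lin0 (ecoord_lin x).
have d0 : sdiff_series (0 : N) = 0 by apply: lin0 (@sdiff_series_lin _ _ D).
have neq (P : Prop) (x y : k^o) : ~ P -> y = (if pselect P then x else y).
  by move=> nP; case: pselect.
have yes (P : Prop) (x y : k^o) : P -> x = (if pselect P then x else y).
  by move=> p; case: pselect.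
have head0 (f : N) : (forall w, ((f : series letter D) w).1 =
  0) -> smap uhead_lin f = 0 :> N.
  by move=> f0; apply: seriesP => w;
    rewrite [LHS]/(uhead ((f : series letter D) w)) /uhead f0.
have coef0 m (f : N) : (forall w, ((f : series letter D) w).2 =
  0) -> smap (ucoef_lin m) f = 0 :> N.
  move=> f0; apply: seriesP => w;
    rewrite [LHS]/(ucoef m ((f : series letter D) w)) /ucoef f0.
  by rewrite (lin0 (phi_lin m)) scale0r.
have ecM m (f : N) : ecoord (WMon m) f =
  phi m ((f : series letter D) [::]).2 by [].
have ecR x f : ecoord (WR x) f =
  ecoord x (sdiff_series (smap uhead_lin f)) by [].
have ecRM x m f : ecoord (WRMon x m) f =
  ecoord x (sdiff_series (smap (ucoef_lin m) f)) by [].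
have evR x : ev (WR x) = srb (ev x : N) by [].
have evE m : ev (WMon m) = cA (vec (val m)) by apply: ev_monomial (svalP m).
move=> uE; elim: uE v => {u} [m mE|x xE IH|x m xE IH gx mE] v.
- case=> {v} [m' m'E|y _|y m' yE gy m'E].
  + rewrite evE /= phi_vec //.
    case: eqP => [->|mm']; first by case: pselect.
    by apply: neq => -[/esym].
  + by rewrite ecM evR srb_H (lin0 (phi_lin m)); apply: neq.
  + rewrite ecM ev_WRMon.
    (* At the empty word R(y) has value [sig] of y, which vanishes because R(y) is good. *)
    rewrite srb_nil [sd_sig _](ev_good yE gy) (lin0 (amul_linearl _)).
    by rewrite (lin0 (phi_lin m)); apply: neq.
- case=> {v} [m' m'E|y yE|y m' yE gy m'E].
  + rewrite ecR head0 ?d0 ?l0; first exact: neq.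
    by move=> w; rewrite evE; case: w.
  + rewrite ecR (_ : smap _ _ = srb (ev y : N)).
      rewrite sdiff_seriesK IH //; case: pselect => xy; first by apply: yes;
        rewrite xy.
      by apply: neq => -[].
    apply: seriesP => w; rewrite [LHS]/(uhead (srb (ev y : N) w)) /uhead.
    by rewrite -(srb_H (ev y) w); case: (srb _ w).
  + rewrite ecR head0 ?d0 ?l0; first exact: neq.
    by move=> w; have [a [_ E]] := ev_WRMon_scalar m' yE gy w;
      rewrite [X in X.1]E.
- case=> {v} [m' m'E|y yE|y m' yE gy m'E].
  + rewrite ecRM (_ : smap _ _ =
      @const_series k letter D (phi m (vec (val m')) *: sd_one D)).
      (* A monomial yields a constant scalar series, which the derivation kills. *)
      by rewrite sdiff_const_one l0; apply: neq.
    apply: seriesP => w; rewrite evE.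
    case: w => [//|z w]; rewrite [LHS]/(ucoef m 0).
    exact: (lin0 (ucoef_lin m)).
  + rewrite ecRM coef0 ?d0 ?l0; first exact: neq.
    by move=> w; apply: srb_H.
  + rewrite ecRM (_ : smap _ _ = ((m' == m)%:R : k) *: srb (ev y : N)).
      rewrite (linZ (@sdiff_series_lin _ _ D)) (linZ (ecoord_lin x)).
      rewrite sdiff_seriesK IH //; case: eqP => [->|mm'].
        rewrite scale1r; case: pselect => xy; first by apply: yes; rewrite xy.
        by apply: neq => -[].
      by rewrite scale0r; apply: neq => -[_ /esym].
    apply: seriesP => w; have [a [E1 E2]] := ev_WRMon_scalar m' yE gy w.
    rewrite [LHS]/(ucoef m ((ev (WRMon y m') : N) w)) E2.
    rewrite [RHS]/(_ *: srb (ev y :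
      N) w) E1 /ucoef (linZ (phi_lin m)) phi_vec //.
    by apply/esym; apply: etrans (scalerA _ _ _) _; rewrite mulrC.
Qed.

End Model.

(** * Coordinate functionals dual to the E-words *)

Section Independence.
Variables (k : fieldType) (C : precomm k) (I : choiceType) (b : I -> C).
Variable (E0 : monomial I -> Prop).
Hypothesis hb : linear_basis (fun _ : I => True) b.
Hypothesis hE0 : basis_mod (@no_const k I) (ideal b) E0
  (fun m => << val m >> : {malg k[{cmonom I}]}).

Notation lf := (lf hb).
Notation nf := (nf hE0).
Notation emb := (@emb k I).
Notation A := (amodel hE0).

Definition amodel_el (c : C) : A := nf (lf c).
Definition amodel_deg1 (a : A) : C := deg1 b (emb a).
(** All nonlinear monomials occur, inside and outside [E0], because the carrier of [amodel] is the
    whole of k[B]. *)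
Definition nonlinear : Type := {m : monomial I | mdeg (val m) != 1%N}.
Definition amodel_xi (m : nonlinear) : A := << val m >>.
Definition amodel_co (m : nonlinear) (a : A) : k^o := a@_(val m).

Lemma amodel_el_lin : linear amodel_el.
Proof. exact: lin_comp (nf_lin hE0) (lf_lin hb). Qed.

Lemma amodel_deg1_lin : linear amodel_deg1.
Proof. exact: lin_comp (deg1_lin b) (@emb_lin k I). Qed.

Lemma amodel_elK : cancel amodel_el amodel_deg1.
Proof.
move=> c; rewrite /amodel_deg1 /amodel_el (deg1_nf hb hE0).
exact: deg1_lf.
Qed.

Lemma amodel_act_el c d :
  amodel_act hb hE0 c (amodel_el d) = amodel_el (amul c d).
Proof.
by rewrite /amodel_act /amodel_el (nf_lf hb hE0) (rb_act_lf hb).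
Qed.

Lemma amodel_deg1_act c a :
  amodel_deg1 (amodel_act hb hE0 c a) = amul c (amodel_deg1 a).
Proof. exact: etrans (deg1_nf hb hE0 _) (rb_act_deg1 hb _ _). Qed.

Lemma amodel_deg1_xi x : amodel_deg1 (amodel_xi x) = 0.
Proof.
rewrite /amodel_deg1 /amodel_xi embU deg1U linv0 //.
by case: x.
Qed.

Lemma amodel_co_lin x : linear (amodel_co x).
Proof. by move=> a u v; rewrite /amodel_co mcoeffD mcoeffZ. Qed.

Lemma amodel_co_xi x y : amodel_co x (amodel_xi y) = (y == x)%:R.
Proof. by rewrite /amodel_co mcoeffU -val_eqE mulrb. Qed.

Lemma amodel_co_el x c : amodel_co x (amodel_el c) = 0.
Proof.
rewrite /amodel_co -emb_coef (nf_lf hb hE0) -(deg1_lf hb c) lf_deg1.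
by case: x => m /= /negbTE ->.
Qed.

Lemma amodel_co_fin a : finsup (amodel_co^~ a).
Proof.
exists [fset x in pmap insub (msupp a)]%fset => x; rewrite !inE mem_pmap_sub.
exact: mcoeff_outdom.
Qed.

Lemma amodel_co_sep (a : A) :
  (forall x, amodel_co x a = 0) -> a = amodel_el (amodel_deg1 a).
Proof.
move=> a0; apply: emb_inj; rewrite (nf_lf hb hE0); apply/malgP => m.
rewrite lf_deg1; case: ifP => // m1.
have [->|m0] := eqVneq m mone; first exact: emb_no_const.
pose m' : monomial I := exist _ m m0.
by rewrite (emb_coef a m'); apply: (a0 (exist _ m' (negbT m1))).
Qed.

Definition amodel_vec (m : {cmonom I}) : A := nf << m >>.

Lemma amodel_vec_ucm i : amodel_vec (ucm i) = amodel_el (b i).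
Proof. by rewrite /amodel_vec /amodel_el lf_basis. Qed.

Lemma amodel_vec_mul i (m : {cmonom I}) : m != mone ->
  amodel_vec (mmul (ucm i) m) = amul (amodel_el (b i)) (amodel_vec m).
Proof.
move=> m1; have mE : << mmul (ucm i) m >> =
  << m >> * lf (b i) :> {malg k[{cmonom I}]}.
  by rewrite lf_basis; apply: etrans (mulU k _ _) (mulrC _ _).
have elE := congr1 (fun q => nf (emb (nf << m >>) * q)) (nf_lf hb hE0 (b i)).
apply: etrans (congr1 nf mE) _.
apply: etrans (esym (nf_mul hb hE0 _ (no_constU k m1))) _.
apply: etrans (esym elE) _.
exact: (@amodel_mulC _ _ _ _ _ hE0).
Qed.

Lemma amodel_deg1_vec m : mdeg m != 1%N -> amodel_deg1 (amodel_vec m) = 0.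
Proof.
move=> m1; apply: etrans (deg1_nf hb hE0 _) _.
by rewrite deg1U linv0.
Qed.

Definition amodel_coef (m : monomial I) (a : A) : k^o := a@_m.

Lemma amodel_coef_lin m : linear (amodel_coef m).
Proof. by move=> x a a'; rewrite /amodel_coef mcoeffD mcoeffZ. Qed.

Lemma amodel_coef_vec (m m' : monomial I) : E0 m' ->
  amodel_coef m (amodel_vec (val m')) = (m' == m)%:R.
Proof.
move=> m'E; rewrite /amodel_coef /amodel_vec -embU nf_emb ?mcoeffU ?mulrb // =>
  n.
by rewrite msuppU oner_eq0 in_fset1 => /eqP ->.
Qed.

(** One target algebra with such functionals suffices: a homomorphism from C factors through the
    enveloping algebra, and the functionals pull back. *)
Lemma word_coordinates :
  exists (N : comRBalg k) (psi : C -> derived N) (ec : word I -> N -> k^o),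
    [/\ alg_hom psi, forall u, linear (ec u) &
      forall u v, Eword E0 u -> Eword E0 v ->
        ec u (word_eval (psi \o b) v) = if pselect (u = v) then 1 else 0].
Proof.
pose N := @umodel_RB k C I b hb A (amodel_act hb hE0) amodel_el amodel_deg1
  nonlinear amodel_xi amodel_co
  (@amodel_mulC _ _ _ _ _ hE0) (@amodel_mulA _ _ _ _ _ hb hE0)
  (amodel_act_linl hb hE0) (amodel_act_linr hb hE0)
  (amodel_actA hb hE0) (amodel_act_mul hb hE0)
  amodel_el_lin amodel_deg1_lin amodel_elK amodel_act_el amodel_deg1_act
  amodel_deg1_xi amodel_co_lin amodel_co_xi amodel_co_el amodel_co_fin
  amodel_co_sep.
exists N; eexists; eexists; split.
- exact: upsi_hom.
- move=> u; exact: (ecoord_lin amodel_coef_lin).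
- apply: ecoord_eq.
  + exact: amodel_vec_ucm.
  + exact: amodel_vec_mul.
  + exact: amodel_deg1_vec.
  + exact: amodel_coef_vec.
Qed.

End Independence.

(** * Linear spans *)

Section LinearSpan.
Variables (k : fieldType) (V : lmodType k).

Inductive lspan (X : Type) (P : X -> Prop) (e : X -> V) : V -> Prop :=
  | lspan0 : lspan P e 0
  | lspan_cons a x v : P x -> lspan P e v -> lspan P e (a *: e x + v).

Variables (X : Type) (P : X -> Prop) (e : X -> V).

Lemma lspan_lin a u v : lspan P e u -> lspan P e v -> lspan P e (a *: u + v).
Proof.
elim=> [|c x w xP _ IH] Sv; first by rewrite scaler0 add0r.
by rewrite scalerDr scalerA -addrA; apply: lspan_cons => //; apply: IH.
Qed.

Lemma lspanD u v : lspan P e u -> lspan P e v -> lspan P e (u + v).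
Proof. by move=> Su Sv; rewrite -[u]scale1r; apply: lspan_lin. Qed.

Lemma lspan_gen x : P x -> lspan P e (e x).
Proof.
by move=> xP; rewrite -[e x]scale1r -[_ *: _]addr0;
  apply: lspan_cons (lspan0 _ _).
Qed.

Lemma lspan_combination v : lspan P e v ->
  exists n (x : 'I_n -> X) (c : 'I_n -> k),
    (forall i, P (x i)) /\ v = combination e x c.
Proof.
elim=> [|a x w xP _ [n [y [c [yP ->]]]]].
  have no0 (T : Type) (i : 'I_0) : T by case: i.
  exists 0%N, (no0 X), (no0 k); split=> [[]//|].
  by rewrite /combination big_ord0.
exists n.+1, (fun i => if unlift ord0 i is Some j then y j else x),
  (fun i => if unlift ord0 i is Some j then c j else a).
split=> [i|]; first by case: unlift.
rewrite /combination big_ord_recl unlift_none; congr (_ + _).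
by apply: eq_bigr => i _; rewrite liftK.
Qed.

End LinearSpan.

Lemma lspan_sub (k : fieldType) (V W : lmodType k) (X Y : Type)
    (P : X -> Prop) (e : X -> V) (Q : Y -> Prop) (h : Y -> W) (f : V -> W) v :
  linear f -> (forall x, P x -> lspan Q h (f (e x))) ->
  lspan P e v -> lspan Q h (f v).
Proof.
move=> f_lin Pf; elim=> [|a x w xP _ IH]; first by rewrite (lin0 f_lin);
  apply: lspan0.
by rewrite f_lin; apply: lspan_lin => //; apply: Pf.
Qed.

(** * The span of the E-words is closed under the operations *)

Section Spanning.
Variables (k : fieldType) (C : precomm k) (I : choiceType) (b : I -> C).
Variable (E0 : monomial I -> Prop).
Hypothesis hb : linear_basis (fun _ : I => True) b.
Hypothesis hE0 : basis_mod (@no_const k I) (ideal b) E0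
  (fun m => << val m >> : {malg k[{cmonom I}]}).
Variables (U : comRBalg k) (phi : C -> derived U).
Hypothesis phi_hom : alg_hom phi.

Notation poly := {malg k[{cmonom I}]}.
Notation J := (ideal b).
Notation lf := (lf hb).
Notation R := (@rbop k U).
Notation g := ((phi : C -> U) \o b).
Notation ev := (word_eval g).
Implicit Types (p q : poly) (c d : C) (x y z : U).

Let mulC := @rb_mulC k U.
Let mulA := @rb_mulA k U.
Let R_lin := (rb_axiom U).1.

Lemma phi_linear : linear (phi : C -> U).
Proof. exact: phi_hom.1. Qed.

Lemma phi_mul c d : (phi (amul c d) : U) = amul (R (phi c)) (phi d).
Proof. exact: phi_hom.2. Qed.

Lemma R_mul x y : amul (R x) (R y) = R (amul (R x) y + amul (R y) x).
Proof. by rewrite (rb_axiom U).2 scale0r addr0 (mulC x). Qed.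

Definition pev p : U := lext (mon_eval g) p.

Lemma pev_lin : linear pev. Proof. exact: lext_lin. Qed.

Lemma pevU m : pev << m >> = mon_eval g m. Proof. exact: lextU. Qed.

Lemma pev_lf c : pev (lf c) = phi c.
Proof.
move: c; apply: (basis_ind hb) => [||i].
- exact: lin_comp pev_lin (lf_lin hb).
- exact: phi_linear.
by rewrite lf_basis pevU mon_eval_var.
Qed.

Lemma pev_mul p q : no_const p -> no_const q ->
  pev (p * q) = amul (pev p) (pev q).
Proof.
move=> p0 q0; apply: (eq_linear (f := fun p => pev (p * q))
  (g := fun p => amul (pev p) (pev q))).
- exact: lin_comp pev_lin (mul_linl q).
- exact: lin_comp (amul_linearl _) pev_lin.
move=> m /(no_const_supp p0) m1; apply: (eq_linear
  (f := fun q => pev (<< m >> * q)) (g := fun q => amul (pev << m >>) (pev q))).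
- exact: lin_comp pev_lin (mul_linr _).
- exact: lin_comp (amul_linearr _) pev_lin.
move=> m' m'1; apply: etrans (congr1 pev (esym (mulU k m m'))) _.
apply: etrans (pevU _) _; apply: etrans (mon_evalM g m1 _) _.
  exact: no_const_supp q0 m'1.
exact: (congr2 _ (esym (pevU m)) (esym (pevU m'))).
Qed.

Lemma no_const_ucm i : no_const (<< ucm i >> : poly).
Proof. by apply: no_constU; rewrite cm1_eq1. Qed.

(** On generators, (b > a)c becomes R(b)ac, which is symmetric in a and c. *)
Lemma pev_J p : J p -> pev p = 0.
Proof.
elim=> {p} [i j l p q /(linear_formE hb) -> /(linear_formE hb) ->||p q _ p0 _ q0
  |a p _ p0|p q p0 Jq q0].
- have pevM c i' : pev (lf c * << ucm i' >>) = amul (phi c : U) (g i').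
    apply: etrans (pev_mul (no_const_lf hb c) (no_const_ucm i')) _.
    by rewrite pev_lf pevU mon_eval_var.
  apply: etrans (linB pev_lin _ _) _; apply: etrans (congr2 _ (pevM _ _)
    (congr1 -%R (pevM _ _))) _.
  by rewrite !phi_mul -!mulA (mulC (g l)) subrr.
- exact: lin0 pev_lin.
- by rewrite (linD pev_lin) p0 q0 addr0.
- by rewrite (linZ pev_lin) p0 scaler0.
have [q1 _] := J_props hb Jq.
by rewrite (pev_mul p0 q1) q0 (lin0 (amul_linearr _)).
Qed.

Lemma pev_nf p : no_const p -> pev (emb (nf hE0 p)) = pev p.
Proof.
move=> p0; have /eqP := pev_J (nf_J hE0 p0).
by rewrite (linB pev_lin) subr_eq0 => /eqP.
Qed.

Lemma pev_act c p : no_const p ->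
  pev (rb_act hb c p) = amul (R (phi c)) (pev p).
Proof.
move=> p0; apply: (eq_linear (f := fun p => pev (rb_act hb c p))
  (g := fun p => amul (R (phi c)) (pev p))).
- exact: lin_comp pev_lin (rb_act_linr hb c).
- exact: lin_comp (amul_linearr _) pev_lin.
move=> m /(no_const_supp p0) m1; have [i [m' [E hE]]] := head_letterP m1.
rewrite rb_actU /rb_head hE E [in RHS]pevU.
have [->|m'1] := eqVneq m' mone.
  rewrite mulm1 mon_eval_var -phi_mul -pev_lf; congr pev.
  exact: mulr1.
rewrite mon_evalM ?cm1_eq1 // mon_eval_var mulA -phi_mul -pev_lf -pevU.
exact: pev_mul (no_const_lf hb _) (no_constU k m'1).
Qed.

Notation S := (lspan (Eword E0) ev).
Notation G := (lspan (fun u => Eword E0 u /\ good u) ev).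

Definition polynomial z := exists p, no_const p /\ z = pev p.
Definition nonlinear_polynomial z :=
  exists p, [/\ no_const p, deg1 b p = 0 & z = pev p].

Notation E0span P := (lspan (fun m : monomial I => E0 m /\ P m)
  (fun m => mon_eval g (val m))).

Lemma nf_span (P : monomial I -> Prop) p : no_const p ->
  (forall m, m \in msupp (nf hE0 p) -> P m) -> E0span P (pev p).
Proof.
move=> p0 mP; rewrite -(pev_nf p0) [X in emb X]malg_sum.
rewrite (lin_sum (@emb_lin k I)) (lin_sum pev_lin) big_seq.
elim/big_rec: _ => [|m x mS Sx]; first exact: lspan0.
rewrite (linZ (@emb_lin k I)) (linZ pev_lin) embU pevU; apply: lspan_cons => //.
by split; [apply: (nf_E0 mS) | apply: mP].
Qed.

Lemma polynomial_span z : polynomial z -> E0span (fun _ => True) z.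
Proof. by move=> [p [p0 ->]]; apply: nf_span. Qed.

(** Normal forms keep the linear part; if it vanishes, no single letter enters the support. *)
Lemma nonlinear_span z : nonlinear_polynomial z ->
  E0span (fun m => mdeg (val m) != 1%N) z.
Proof.
move=> [p [p0 p1 ->]]; apply: nf_span => // m; apply: contraL => m1.
have := lf_deg1 hb (emb (nf hE0 p)) (val m).
rewrite m1 (deg1_nf hb hE0) p1 (lin0 (lf_lin hb)) emb_coef => E.
by rewrite -mcoeff_eq0 -E mcoeff0.
Qed.

Lemma good_mon (m : monomial I) : mdeg (val m) != 1%N -> good (WMon m).
Proof. by move=> m1 i mi; move: m1; rewrite mi mdegU. Qed.

Lemma polynomial_S z : polynomial z -> S z.
Proof.
move=> /polynomial_span; apply: (lspan_sub (f := idfun)) => // m [mE _].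
by apply: (lspan_gen _ (x := WMon m)); apply: Eword1.
Qed.

Lemma nonlinear_G z : nonlinear_polynomial z -> G z.
Proof.
move=> /nonlinear_span; apply: (lspan_sub (f := idfun)) => // m [mE m1].
apply: (lspan_gen _ (x := WMon m)); split; [exact: Eword1 | exact: good_mon].
Qed.

Lemma G_S z : G z -> S z.
Proof. by apply: (lspan_sub (f := idfun)) => // x [xE _]; apply: lspan_gen. Qed.

Lemma G_mul x z : G x -> polynomial z -> S (amul (R x) z).
Proof.
move=> Gx /polynomial_span Sz.
move: Gx; apply: (lspan_sub (f := fun x => amul (R x) z)) => [|u [uE ug]].
  exact: lin_comp (amul_linearl z) R_lin.
move: Sz; apply: (lspan_sub (amul_linearr _)) => m [mE _].
by apply: (lspan_gen _ (x := WRMon u m)); apply: Eword3.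
Qed.

Lemma G_mul_nonlinear x z : G x -> nonlinear_polynomial z -> G (amul (R x) z).
Proof.
move=> Gx /nonlinear_span Sz.
move: Gx; apply: (lspan_sub (f := fun x => amul (R x) z)) => [|u [uE ug]].
  exact: lin_comp (amul_linearl z) R_lin.
move: Sz; apply: (lspan_sub (amul_linearr _)) => m [mE m1].
apply: (lspan_gen _ (x := WRMon u m)); split; first exact: Eword3.
exact: good_mon.
Qed.

(** R(R(u)) is always good, so the image of R needs no reduction. *)
Lemma S_R x : S x -> G (R x).
Proof.
apply: (lspan_sub R_lin) => u uE.
by apply: (lspan_gen _ (x := WR u)); split=> //; apply: Eword2.
Qed.

Lemma polynomial_mon (m : monomial I) : polynomial (mon_eval g (val m)).
Proof.
exists << val m >>; rewrite pevU; split=> //.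
exact: no_constU (svalP m).
Qed.

Lemma polynomial_phi c : polynomial (phi c).
Proof. by exists (lf c); rewrite pev_lf; split=> //; apply: no_const_lf. Qed.

Lemma polynomial_mul x y :
  polynomial x -> polynomial y -> polynomial (amul x y).
Proof.
move=> [p [p0 ->]] [q [q0 ->]]; exists (p * q).
by rewrite (pev_mul p0 q0); split=> //; apply: no_const_mul p0.
Qed.

Lemma polynomial_act c z : polynomial z -> polynomial (amul (R (phi c)) z).
Proof.
move=> [p [p0 ->]]; exists (rb_act hb c p); rewrite (pev_act c p0).
by split=> //; apply: rb_act_no_const.
Qed.

Lemma nonlinear_act c (m : monomial I) : mdeg (val m) != 1%N ->
  nonlinear_polynomial (amul (R (phi c)) (mon_eval g (val m))).
Proof.
move=> m1; exists (rb_act hb c << val m >>).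
have m0 := no_constU k (svalP m).
rewrite (pev_act c m0) pevU (rb_act_deg1 hb) deg1U (linv0 b m1).
by rewrite (lin0 (amul_linearr c)); split=> //; apply: rb_act_no_const.
Qed.

(* For x = y b with b a letter, R(y b) z is rewritten by means of
   R(R(y) b) = R(y) R(b) - R(y R(b)). *)
Lemma Eword_reduce u : Eword E0 u ->
  [/\ forall z, polynomial z -> S (amul (R (ev u)) z),
      forall c, S (amul (R (phi c)) (ev u)) &
      good u -> forall c, G (amul (R (phi c)) (ev u))].
Proof.
elim=> {u} [m mE|u uE [Pu Qu _]|x m xE [Px Qx GQx] gx mE].
- have [m1|m1] := boolP (mdeg (val m) == 1%N); last first.
    have Gm : G (ev (WMon m)).
      by apply: (lspan_gen _ (x := WMon m)); split;
        [exact: Eword1 | exact: good_mon].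
    split=> [z|c|_ c]; first exact: G_mul.
      by apply/polynomial_S/polynomial_act/polynomial_mon.
    by apply/nonlinear_G/nonlinear_act.
  have [i mi] := mdeg1P _ m1; split=> [z|c|/(_ i)].
  + rewrite /= mi mon_eval_var => zP.
    exact/polynomial_S/polynomial_act.
  + by apply/polynomial_S/polynomial_act/polynomial_mon.
  + by rewrite mi.
- have Q' c : G (amul (R (phi c)) (ev (WR u))).
    rewrite [ev _]/= R_mul; apply: S_R; apply: lspanD; first exact: Qu.
    exact/Pu/polynomial_phi.
  split=> [z||_] //; last by move=> c; apply/G_S/Q'.
  by apply: G_mul; apply: (lspan_gen _ (x := WR u)); split=> //; apply: Eword2.
have Gx : G (ev x) by apply: lspan_gen.
have swap c : amul (R (phi c)) (ev (WRMon x m)) =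
    amul (R (ev x)) (amul (R (phi c)) (mon_eval g (val m))).
  by rewrite /= !mulA (mulC (R (phi c))).
have Q c : S (amul (R (phi c)) (ev (WRMon x m))).
  by rewrite swap; apply/Px/polynomial_act/polynomial_mon.
have [m1|m1] := boolP (mdeg (val m) == 1%N); last first.
  split=> [z||_ c] //; last by rewrite swap;
    apply: G_mul_nonlinear Gx (nonlinear_act _ m1).
  apply: G_mul; apply: (lspan_gen _ (x := WRMon x m)).
  by split; [exact: Eword3 | exact: good_mon].
have [i mi] := mdeg1P _ m1; split=> [z zP||/(_ i)] //.
have -> : R (ev (WRMon x m)) =
    amul (R (ev x)) (R (phi (b i))) - R (amul (R (phi (b i))) (ev x)).
  by rewrite R_mul (linD R_lin) addrK /= mi mon_eval_var.
(* To multiply R(R(b)x) by [z], R(b)x must lie in the span of good words; the third conclusion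
   exists for this purpose. *)
rewrite (linB (amul_linearl z)) -scaleN1r addrC; apply: lspan_lin.
  by apply: G_mul => //; apply: GQx.
by rewrite -mulA; apply: G_mul => //; apply: polynomial_act.
Qed.

Lemma S_R_mul x z : S x -> polynomial z -> S (amul (R x) z).
Proof.
move=> Sx zP; move: Sx; apply: (lspan_sub (f := fun x => amul (R x) z)).
  exact: lin_comp (amul_linearl z) R_lin.
by move=> u /Eword_reduce[+ _ _]; apply.
Qed.

Fixpoint word_size (u : word I) : nat :=
  match u with
  | WMon _ => 0
  | WR x => (word_size x).+1
  | WRMon x _ => (word_size x).+1
  end.

(** If [v] starts with R, the Rota-Baxter identity replaces R(u)R(y) by R(R(u)y + R(y)u), and each
    product inside has one R less. *)
Lemma Eword_R_mul u v : Eword E0 u -> Eword E0 v -> S (amul (R (ev u)) (ev v)).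
Proof.
have [n] := ubnP (word_size u + word_size v);
  elim: n u v => // n IH u v + uE vE.
case: vE => {v} [m mE|v vE|v m vE gv mE] /=; rewrite ?addnS ltnS => uvn.
- by move=> *; apply: S_R_mul (polynomial_mon m); apply: lspan_gen.
- rewrite R_mul; apply/G_S/S_R/lspanD; first exact: IH.
  by apply: IH => //; rewrite addnC.
rewrite mulA R_mul; apply: S_R_mul (polynomial_mon m); apply: lspanD.
  exact: IH.
by apply: IH => //; rewrite addnC.
Qed.

Lemma S_RM x y : S x -> S y -> S (amul (R x) y).
Proof.
move=> Sx Sy; move: Sx; apply: (lspan_sub (f := fun x => amul (R x) y)).
  exact: lin_comp (amul_linearl y) R_lin.
move=> u uE; move: Sy; apply: (lspan_sub (amul_linearr _)) => v vE.
exact: Eword_R_mul.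
Qed.

Lemma S_mul_polynomial x z : S x -> polynomial z -> S (amul x z).
Proof.
move=> Sx zP; move: Sx; apply: (lspan_sub (amul_linearl z)) => u.
case=> {u} [m mE|u uE|u m uE gu mE] /=.
- by apply/polynomial_S/polynomial_mul => //; apply: polynomial_mon.
- by apply: S_R_mul => //; apply: lspan_gen.
rewrite -mulA; apply: S_R_mul; first exact: lspan_gen.
by apply: polynomial_mul => //; apply: polynomial_mon.
Qed.

Lemma S_mul x y : S x -> S y -> S (amul x y).
Proof.
move=> Sx Sy; move: Sx; apply: (lspan_sub (amul_linearl y)) => u.
case=> {u} [m mE|u uE|u m uE gu mE] /=.
- by rewrite mulC; apply: S_mul_polynomial => //; apply: polynomial_mon.
- by apply: S_RM => //; apply: lspan_gen.
rewrite -mulA (mulC (mon_eval _ _)) mulA.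
apply: S_mul_polynomial (polynomial_mon m).
by apply: S_RM => //; apply: lspan_gen.
Qed.

Lemma S_teval t : S (teval (phi : C -> U) t).
Proof.
elim: t => [c||s Ss t St|a s Ss|s Ss t St|s Ss] /=.
- exact/polynomial_S/polynomial_phi.
- exact: lspan0.
- exact: lspanD.
- by rewrite -[_ *: _]addr0; apply: lspan_lin => //; apply: lspan0.
- exact: S_mul.
- exact/G_S/S_R.
Qed.

End Spanning.

(** * Generation of the enveloping algebra by C, and the basis theorem *)

Lemma universal_envelope_gen (k : fieldType) (C : precomm k) (U : comRBalg k)
    (phi : C -> derived U) : universal_envelope phi ->
  forall x : U, exists t : term k C, x = teval (phi : C -> U) t.
Proof.
move=> [[phi_lin phiM] univ] x.
pose rel := @env_rel k C; pose psi y := cl rel (TGen k y).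
have psi_hom : @alg_hom k C (derived (pres_RB rel)) psi.
  split=> [a y z|y z] /=.
    have E : a *: psi y + psi z =
        cl rel (TAdd (TScale a (TGen k y)) (TGen k z)) by rewrite presZ presD.
    by apply: etrans (esym E); apply/cl_eq/cong_rel/env_linear.
  by rewrite /dmul /psi /= qRE qmulE; apply/cl_eq/cong_rel/env_mul.
have [f [f_hom f_psi _]] := univ _ _ psi_hom.
have phi_rel s t : rel s t -> teval (phi : C -> U) s = teval (phi : C -> U) t.
  by case=> [a y z|y z] /=; [apply: phi_lin | apply: phiM].
have [[l_lin lM] lR] := pres_lift_hom phi_rel.
have [[f_lin fM] fR] := f_hom.
have [h [_ _ h_uniq]] := univ U phi (conj phi_lin phiM).
have id_h : id =1 h by apply: h_uniq.
(* The round trip through the presented algebra fixes the image of C, so uniqueness makes it the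
   identity; a representative of [f x] is then the required expression. *)
have lf_h : pres_lift (phi : C -> U) \o f =1 h.
  apply: h_uniq => [|y /=]; last by rewrite f_psi pres_liftE.
  split; [split=> [a y z|y z]|move=> y] => /=.
  - by rewrite f_lin l_lin.
  - by rewrite fM lM.
  - by rewrite fR lR.
exists (rep (f x)); rewrite [LHS]id_h -lf_h /=.
by rewrite -[in LHS](repK (f x)) pres_liftE.
Qed.

Theorem theorem2 (k : fieldType) (C : precomm k) (I : choiceType) (b : I -> C)
    (E0 : monomial I -> Prop)
    (F : comRBalg k) (iota : I -> F)
    (U : comRBalg k) (phi : C -> derived U) (pi : F -> U) :
  linear_basis (fun _ : I => True) b ->
  admissible b E0 ->
  free_comRB iota ->
  universal_envelope phi ->
  rb_hom pi -> (forall i, pi (iota i) = phi (b i)) ->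
  (forall u v : word I, Eword E0 u -> Eword E0 v ->
     pi (word_eval iota u) = pi (word_eval iota v) -> u = v) /\
  linear_basis (Eword E0) (fun u : word I => pi (word_eval iota u)).
Proof.
move=> hb [hE0 _] _ hU pi_hom pi_iota.
have evE u : pi (word_eval iota u) = word_eval ((phi : C -> U) \o b) u.
  rewrite (word_eval_hom _ _ pi_hom); congr word_eval.
  by apply/funext => i; apply: pi_iota.
have [N [psi [ec [psi_hom ec_lin ecE]]]] := word_coordinates hb hE0.
(* Composing with [f] transports the dual functionals [ec] to [U]; they give both distinctness and
   independence. *)
have [f [f_hom f_phi _]] := hU.2 N psi psi_hom; have [[f_lin _] _] := f_hom.
have fE u : f (word_eval ((phi : C -> U) \o b) u) = word_eval (psi \o b) u.
  rewrite (word_eval_hom _ _ f_hom); congr word_eval.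
  by apply/funext => i; apply: f_phi.
split.
  move=> u v uE vE /(congr1 f); rewrite !evE !fE => /(congr1 (ec u)).
  rewrite !ecE //; case: (pselect (u = v)) => // uv.
  by case: (pselect (u = u)) => // uu /eqP; rewrite oner_eq0.
have -> : (fun u : word I => pi (word_eval iota u)) =
    word_eval ((phi : C -> U) \o b) by apply/funext.
split=> // [n x c x_inj xE /(congr1 f) x0 i|v _].
  have := congr1 (ec (x i)) x0; rewrite (lin0 f_lin) (lin0 (ec_lin _)) => <-.
  rewrite /combination (lin_sum f_lin) (lin_sum (ec_lin _)) (bigD1 i) //=.
  rewrite (linZ f_lin) (linZ (ec_lin _)) fE ecE //; case: pselect => // xi.
  rewrite big1 ?addr0 => [|j ji]; first exact/esym/mulr1.
  rewrite (linZ f_lin) (linZ (ec_lin _)) fE ecE //.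
  case: pselect => xij; last exact: mulr0.
  by rewrite (x_inj _ _ xij) eqxx in ji.
have [t ->] := universal_envelope_gen hU v.
have [n [x [c [xE ->]]]] := lspan_combination (S_teval hb hE0 hU.1 t).
by exists n, x, c; rewrite subrr.
Qed.
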